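(* Let $J$ be a non-infinitesimal interval of ${}^\bullet\mathbb{R}$ and let $f,g:J\to{}^\bullet\mathbb{R}$ be smooth functions. Let $a,b\in J$ with $a<b$. If $g(x)\le f(x)$ for all $x\in[a,b]$, then $\int_a^b g\le\int_a^b f$.
   Context: Fermat reals: let $\mathbb{R}_o[t]$ be the set of maps $x:\mathbb{R}_{\ge0}\to\mathbb{R}$, $t\mapsto x_t$, of the form $x_t=r+\sum_{i=1}^k\alpha_i t^{a_i}+o(t)$ as $t\to0^+$, with $k\in\mathbb{N}$, $r,\alpha_i\in\mathbb{R}$, $a_i\in\mathbb{R}_{\ge0}$. Write $x\sim y$ iff $x_t=y_t+o(t)$ as $t\to0^+$. The ring of Fermat reals is ${}^\bullet\mathbb{R}:=\mathbb{R}_o[t]/\sim$ with pointwise operations; $\mathbb{R}\subseteq{}^\bullet\mathbb{R}$ via constants. The standard part of $x=[x_t]$ is ${}^\circ x:=x_0$. ${}^\bullet\mathbb{R}$ is totally ordered by: $x\le y$ iff for representatives there is $z\in\mathbb{R}_o[t]$ with $z\sim0$ and $x_t\le y_t+z_t$ for all small $t\ge0$; $[a,b]:=\{x\in{}^\bullet\mathbb{R}:a\le x\le b\}$. $\overline{{}^\bullet\mathbb{R}}:={}^\bullet\mathbb{R}\cup\{\pm\infty\}$, ${}^\circ(\pm\infty):=\pm\infty$. An interval is a set $[a,b],(a,b),[a,b),(a,b]$ of points of ${}^\bullet\mathbb{R}$ with $a\le b$ in $\overline{{}^\bullet\mathbb{R}}$; non-infinitesimal if ${}^\circ a<{}^\circ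 b$. The Fermat topology on ${}^\bullet\mathbb{R}^n$ has open sets ${}^\bullet V:=\{x:{}^\circ x\in V\}$, $V\subseteq\mathbb{R}^n$ open. For $\alpha\in C^\infty(W,\mathbb{R}^m)$, $W\subseteq\mathbb{R}^d$ open, ${}^\bullet\alpha([x_t]):=[\alpha(x_t)]$. A map $f:S\to{}^\bullet\mathbb{R}^m$, $S\subseteq{}^\bullet\mathbb{R}^n$, is smooth if for every $x\in S$ there exist open $V\subseteq\mathbb{R}^n$ with $x\in{}^\bullet V$, open $P\subseteq\mathbb{R}^{\mathsf p}$, $p\in{}^\bullet P$, $\alpha\in C^\infty(P\times V,\mathbb{R}^m)$ with $f(y)={}^\bullet\alpha(p,y)$ for $y\in{}^\bullet V\cap S$. For $g$ smooth on a non-infinitesimal interval $J$ and $x\in J$, $g'(x):={}^\bullet(\partial_2\alpha)(p,x)$ for any local representation of $g$ around $x$ (independent of it). Integral: for a non-infinitesimal interval $J$, smooth $f:J\to{}^\bullet\mathbb{R}$ and $u\in J$, $\int_u^{(-)}f$ is the unique smooth $I:J\to{}^\bullet\mathbb{R}$ with $I(u)=0$ and $I'(x)=f(x)$ for all $x\in J$, and $\int_u^v f:=I(v)$ for $v\in J$. *)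

(* Defs.v *)
From HB Require Import structures.
From mathcomp Require Import all_boot all_order all_algebra.
From mathcomp Require Import all_classical all_reals all_analysis.
Set Implicit Arguments. Unset Strict Implicit. Unset Printing Implicit Defensive.
Import Order.TTheory GRing.Theory Num.Theory.
Import numFieldNormedType.Exports.
Local Open Scope classical_set_scope.
Local Open Scope ring_scope.

Section Fermat.
Variable R : realType.

Definition littleo_t (h : R -> R) : Prop :=
  h 0 = 0 /\ (fun t => h t / t) @ 0^'+ --> (0 : R).

Definition Rot (x : R -> R) : Prop :=
  exists (k : nat) (r : R) (al a : 'I_k -> R),
    (forall i, 0 <= a i) /\
    littleo_t (fun t => x t - (r + \sum_(i < k) al i * t `^ (a i))).

Definition fsim (x y : R -> R) : Prop := littleo_t (fun t => x t - y t).

Definition FR : Type :=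
  {A : set (R -> R) | exists x, Rot x /\ A = [set y | Rot y /\ fsim x y]}.

Definition rep (X : FR) (x : R -> R) : Prop := proj1_sig X x.

Definition is_real (X : FR) (r : R) : Prop := rep X (fun _ => r).

Definition std (X : FR) (r : R) : Prop := exists x, rep X x /\ x 0 = r.

Definition fle (X Y : FR) : Prop :=
  exists x y, rep X x /\ rep Y y /\
    exists z, Rot z /\ fsim z (fun _ => 0) /\
      exists d : R, 0 < d /\ forall t, 0 <= t -> t < d -> x t <= y t + z t.
Definition flt (X Y : FR) : Prop := fle X Y /\ X <> Y.

Inductive eFR : Type := EFin of FR | EPinf | ENinf.

Definition efle (a b : eFR) : Prop :=
  match a, b with
  | ENinf, _ => True
  | _, EPinf => True
  | EFin x, EFin y => fle x y
  | _, _ => False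
  end.

Definition estd (a : eFR) (r : \bar R) : Prop :=
  match a with
  | EFin x => exists s, std x s /\ r = s%:E
  | EPinf => r = +oo%E
  | ENinf => r = -oo%E
  end.

Definition ninf_interval (J : set FR) : Prop :=
  exists a b : eFR, efle a b /\
    (exists ra rb, estd a ra /\ estd b rb /\ (ra < rb)%E) /\
    (J = [set x | efle a (EFin x) /\ efle (EFin x) b] \/
     J = [set x | (efle a (EFin x) /\ a <> EFin x) /\ (efle (EFin x) b /\ EFin x <> b)] \/
     J = [set x | efle a (EFin x) /\ (efle (EFin x) b /\ EFin x <> b)] \/
     J = [set x | (efle a (EFin x) /\ a <> EFin x) /\ efle (EFin x) b]).

Fixpoint Ck (n k : nat) (U : set 'rV[R]_n) (G : 'rV[R]_n -> R) : Prop :=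
  match k with
  | 0 => forall z, U z -> {for z, continuous G}
  | k'.+1 => (forall z, U z -> {for z, continuous G}) /\
      forall i : 'I_n, (forall z, U z -> derivable G z (delta_mx 0 i)) /\
        Ck k' U (fun z => 'D_(delta_mx 0 i) G z)
  end.
Definition Cinf (n : nat) (U : set 'rV[R]_n) (G : 'rV[R]_n -> R) : Prop :=
  forall k, Ck k U G.

Definition smooth_on_prod (q : nat) (P : set 'rV[R]_q) (V : set R)
    (alpha : 'rV[R]_q -> R -> R) : Prop :=
  Cinf [set z : 'rV[R]_(q + 1) | P (lsubmx z) /\ V (rsubmx z 0 0)]
       (fun z => alpha (lsubmx z) (rsubmx z 0 0)).

Definition in_ext (V : set R) (x : FR) : Prop := exists r, std x r /\ V r.
Definition in_extv (q : nat) (P : set 'rV[R]_q) (p : 'I_q -> FR) : Prop :=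
  exists v : 'rV[R]_q, (forall i, std (p i) (v 0 i)) /\ P v.

Definition fext (q : nat) (alpha : 'rV[R]_q -> R -> R) (p : 'I_q -> FR)
    (y : FR) (Z : FR) : Prop :=
  exists (pr : 'I_q -> R -> R) (yr : R -> R),
    (forall i, rep (p i) (pr i)) /\ rep y yr /\
    rep Z (fun t => alpha (\row_i pr i t) (yr t)).

Definition local_rep (S : set FR) (f : FR -> FR) (x : FR) (V : set R)
    (q : nat) (P : set 'rV[R]_q) (p : 'I_q -> FR)
    (alpha : 'rV[R]_q -> R -> R) : Prop :=
  open V /\ in_ext V x /\ open P /\ in_extv P p /\ smooth_on_prod P V alpha /\
  forall y, in_ext V y -> S y -> fext alpha p y (f y).

Definition fsmooth (S : set FR) (f : FR -> FR) : Prop :=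
  forall x, S x -> exists V q P p alpha, @local_rep S f x V q P p alpha.

Definition fderiv (J : set FR) (g : FR -> FR) (x : FR) (d : FR) : Prop :=
  exists V q P p alpha, @local_rep J g x V q P p alpha /\
    fext (fun pv s => derive1 (alpha pv) s) p x d.

Definition is_integral_fun (J : set FR) (f : FR -> FR) (u : FR)
    (I : FR -> FR) : Prop :=
  fsmooth J I /\ is_real (I u) 0 /\ forall x, J x -> fderiv J I x (f x).

End Fermat.

(* Main.v *)
Require Import Defs.
From mathcomp Require Import all_boot all_order all_algebra.
From mathcomp Require Import all_classical all_reals all_analysis.
From mathcomp Require Import ring lra.
Set Implicit Arguments. Unset Strict Implicit. Unset Printing Implicit Defensive.
Import Order.TTheory GRing.Theory Num.Theory.
Import numFieldNormedType.Exports.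
Local Open Scope classical_set_scope.
Local Open Scope ring_scope.

(** On a segment [x + s (y - x)], [s] in [0, 1], the difference of the local
representatives of the two integrals has an [s]-derivative [h_t phi_t(s)], where
[h = y - x >= 0] and [phi] represents [f - g].  By Taylor's formula, [phi_t(s)]
is, uniformly in [s], a finite sum of terms [t^e B(s)] with [B] continuous, up
to [o(t)].  So either [phi = o(t)] uniformly, or
[phi_t(s) = t^e (L(s) + o(1))] uniformly with [e <= 1] and [L <> 0].  In the
second case the pointwise inequality [phi >= -o(t)], which is all that [g <= f]
provides, gives [L >= 0], and the mean value theorem yields a positive
increment.  Note that [phi >= -o(t)] need not hold uniformly in [s]: for
[u(s) = exp(-1/s^2)], the function [u^2 - sqrt(t) u] is nonnegative at every
Fermat real of [0, 1], although its minimum is [-t/4].  The same dichotomy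
shows that derivatives do not depend on the local representation; a supremum
argument on standard parts then globalizes the monotonicity. *)

(** * Uniform asymptotic expansions at [0^'+] *)

Section UniformExpansions.
Variable R : realType.
Implicit Types (e : R) (phi psi h : R -> R -> R) (B : R -> R).

Definition unifo e h : Prop :=
  forall eps, 0 < eps -> \forall t \near 0^'+,
    forall s, 0 <= s <= 1 -> `|h t s| <= eps * t `^ e.

Definition ubounded h : Prop :=
  exists M, \forall t \near 0^'+, forall s, 0 <= s <= 1 -> `|h t s| <= M.

Definition cont01 B : Prop := forall s, 0 <= s <= 1 -> {for s, continuous B}.

Definition uexpansion phi : Prop :=
  exists (I : finType) (e : I -> R) (B : I -> R -> R),
    [/\ forall i, 0 <= e i, forall i, cont01 (B i) &
        unifo 1 (fun t s => phi t s - \sum_i t `^ e i * B i s)].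

Lemma cont01_bounded B : cont01 B ->
  exists2 M, 0 < M & forall s, 0 <= s <= 1 -> `|B s| <= M.
Proof.
move=> cB.
have : compact (B @` `[0, 1]%classic).
  apply: continuous_compact; last exact: segment_compact.
  apply: continuous_in_subspaceT => s; rewrite inE /= in_itv /=; exact: cB.
move=> /compact_bounded [M [_ hM]].
exists (`|M| + 1) => [|s s01]; first by rewrite ltr_pwDr.
apply: (hM (`|M| + 1)); first by rewrite (le_lt_trans (ler_norm M))// ltrDl.
by exists s => //=; rewrite in_itv.
Qed.

Lemma unifo_ext e h h' : (forall t s, h t s = h' t s) -> unifo e h -> unifo e h'.
Proof.
by move=> hh' H eps eps0; apply: filterS (H _ eps0) => t Ht s; rewrite -hh'; exact: Ht.
Qed.

Lemma unifo_le e e' h : e <= e' -> unifo e' h -> unifo e h.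
Proof.
move=> ee' H eps eps0; near=> t => s s01.
have t0 : 0 < t by near: t; exact: nbhs_right_gt.
have t1 : t <= 1 by near: t; apply: nbhs_right_le.
apply: (@le_trans _ _ (eps * t `^ e')).
  by move: s s01; near: t; exact: H.
by rewrite ler_pM2l// ger_powR// t0 t1.
Unshelve. all: by end_near. Qed.

Lemma unifoD e h h' : unifo e h -> unifo e h' -> unifo e (fun t s => h t s + h' t s).
Proof.
move=> H H' eps eps0; near=> t => s s01.
have -> : eps * t `^ e = eps / 2 * t `^ e + eps / 2 * t `^ e by lra.
apply: le_trans (ler_normD _ _) _; apply: lerD; move: s s01; near: t.
  by apply: H; rewrite divr_gt0.
by apply: H'; rewrite divr_gt0.
Unshelve. all: by end_near. Qed.

Lemma unifoMl e g h : ubounded g -> unifo e h -> unifo e (fun t s => g t s * h t s).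
Proof.
move=> [M gM] H eps eps0; near=> t => s s01.
have M1 : 0 < `|M| + 1 by rewrite ltr_pwDr.
have gt : `|g t s| <= `|M| + 1.
  apply: (@le_trans _ _ M); first by move: s s01; near: t.
  by rewrite (le_trans (ler_norm M))// lerDl.
have -> : eps * t `^ e = (`|M| + 1) * ((eps / (`|M| + 1)) * t `^ e).
  by field; rewrite gt_eqF.
rewrite normrM ler_pM//.
by move: s s01 gt => s s01 _; move: s s01; near: t; apply: H; rewrite divr_gt0.
Unshelve. all: by end_near. Qed.

Lemma ubounded_unifo e h : 0 <= e -> unifo e h -> ubounded h.
Proof.
move=> e0 /(unifo_le e0) /(_ _ ltr01) H; exists 1.
by apply: filterS H => t Ht s /Ht; rewrite powRr0 mulr1.
Qed.

Lemma uboundedD g h : ubounded g -> ubounded h -> ubounded (fun t s => g t s + h t s).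
Proof.
move=> [M gM] [N hN]; exists (M + N); apply: filterS2 gM hN => t gt ht s s01.
by rewrite (le_trans (ler_normD _ _))// lerD ?gt ?ht.
Qed.

Lemma powR_itv01 e (t : R) : 0 <= e -> 0 < t <= 1 -> 0 <= t `^ e <= 1.
Proof.
by move=> e0 t01; rewrite powR_ge0 -[leRHS](powRr0 t) ger_powR.
Qed.

Lemma near0_itv01 : \forall t \near (0 : R)^'+, 0 < t <= 1.
Proof.
near=> t; apply/andP; split; near: t; first exact: nbhs_right_gt.
exact: nbhs_right_le.
Unshelve. all: by end_near. Qed.

Lemma ubounded_term e B : 0 <= e -> cont01 B -> ubounded (fun t s => t `^ e * B s).
Proof.
move=> e0 /cont01_bounded[M M0 BM]; exists M; apply: filterS near0_itv01 => t t01 s s01.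
have /andP[p0 p1] := powR_itv01 e0 t01.
by rewrite normrM -[leRHS]mul1r ler_pM ?BM// ger0_norm.
Qed.

Lemma ubounded_sum (I : finType) (P : pred I) (h : I -> R -> R -> R) :
  (forall i, ubounded (h i)) -> ubounded (fun t s => \sum_(i | P i) h i t s).
Proof.
move=> hb; elim: (index_enum I) => [|i r [M IH]].
  by exists 0; near=> t => s _; rewrite big_nil normr0.
have [N hN] := hb i; exists (N + M); apply: filterS2 IH hN => t IHt ht s s01.
rewrite big_cons; case: ifP => _; last first.
  by rewrite (le_trans (IHt _ s01))// lerDr (le_trans _ (ht _ s01)).
by rewrite (le_trans (ler_normD _ _))// lerD ?ht ?IHt.
Unshelve. all: by end_near. Qed.

Lemma uexpansion_bnd phi : uexpansion phi -> ubounded phi.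
Proof.
move=> [I [e [B [e0 cB /(ubounded_unifo ler01) H]]]].
have := uboundedD H (@ubounded_sum I xpredT _ (fun i => ubounded_term (e0 i) (cB i))).
by move=> [M hM]; exists M; apply: filterS hM => t ht s /ht; rewrite subrK.
Qed.

Lemma uexpansion_unifo phi psi :
  uexpansion phi -> unifo 1 (fun t s => psi t s - phi t s) -> uexpansion psi.
Proof.
move=> [I [e [B [e0 cB H]]]] H'; exists I, e, B; split=> //.
by apply: unifo_ext (unifoD H' H) => t s; lra.
Qed.

Lemma unifo0 e h : (forall t s, 0 <= s <= 1 -> h t s = 0) -> unifo e h.
Proof.
by move=> h0 eps eps0; near=> t => s /h0 ->; rewrite normr0 mulr_ge0 ?powR_ge0 ?ltW.
Unshelve. all: by end_near. Qed.

Lemma uexpansion_ext phi psi : (forall t s, phi t s = psi t s) -> uexpansion phi -> uexpansion psi.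
Proof.
by move=> E H; apply: uexpansion_unifo H _; apply: unifo0 => t s _; rewrite E subrr.
Qed.

Lemma uexpansion_term e B : 0 <= e -> cont01 B -> uexpansion (fun t s => t `^ e * B s).
Proof.
move=> e0 cB; exists unit, (fun=> e), (fun=> B); split=> //.
by apply: unifo0 => t s _; rewrite big_const card_unit /= addr0 subrr.
Qed.

Lemma uexpansion_coef B : cont01 B -> uexpansion (fun _ s => B s).
Proof.
move=> cB; apply: uexpansion_ext (uexpansion_term (lexx 0) cB) => t s.
by rewrite powRr0 mul1r.
Qed.

Lemma cont01_cst (c : R) : cont01 (fun=> c).
Proof. by move=> s _; exact: cst_continuous. Qed.

Lemma cont01_id : cont01 id.
Proof. by move=> s _; exact: cvg_id. Qed.

Lemma uexpansion_cst (c : R) : uexpansion (fun _ _ => c).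
Proof. exact: (uexpansion_coef (@cont01_cst c)). Qed.

Lemma uexpansionD phi psi : uexpansion phi -> uexpansion psi ->
  uexpansion (fun t s => phi t s + psi t s).
Proof.
move=> [I [e [B [e0 cB H]]]] [J [e' [B' [e'0 cB' H']]]].
exists (I + J)%type, (fun x => match x with inl i => e i | inr j => e' j end),
  (fun x => match x with inl i => B i | inr j => B' j end).
split; [by case|by case|].
by apply: unifo_ext (unifoD H H') => t s; rewrite big_sumType /=; lra.
Qed.

Lemma uexpansionM phi psi : uexpansion phi -> uexpansion psi ->
  uexpansion (fun t s => phi t s * psi t s).
Proof.
move=> ephi; move: (ephi) => [I [e [B [e0 cB H]]]] [J [e' [B' [e'0 cB' H']]]].
exists (I * J)%type, (fun x => e x.1 + e' x.2), (fun x s => B x.1 s * B' x.2 s).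
split=> [[i j]|[i j] s s01|] /=; first by rewrite addr_ge0.
  by apply: continuousM; [exact: cB|exact: cB'].
have H1 := unifoMl (uexpansion_bnd ephi) H'.
have H2 := unifoMl (@ubounded_sum J xpredT _ (fun j => ubounded_term (e'0 j) (cB' j))) H.
move=> eps eps0; have := unifoD H1 H2 eps0; apply: filterS2 near0_itv01 => t /andP[t0 _].
move=> Ht s s01; apply: le_trans (Ht s s01); rewrite le_eqVlt; apply/orP; left.
apply/eqP; congr (`| _ |).
have -> : \sum_(x : I * J) t `^ (e x.1 + e' x.2) * (B x.1 s * B' x.2 s) =
    (\sum_i t `^ e i * B i s) * (\sum_j t `^ e' j * B' j s).
  rewrite big_distrlr /= pair_big /=; apply: eq_bigr => -[i j] _ /=.
  by rewrite powRD ?(gt_eqF t0) ?implybT//; ring.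
by lra.
Qed.

Lemma uexpansionN phi : uexpansion phi -> uexpansion (fun t s => - phi t s).
Proof.
by move=> /(uexpansionM (uexpansion_cst (-1))); apply: uexpansion_ext => t s; rewrite mulN1r.
Qed.

Lemma uexpansionB phi psi : uexpansion phi -> uexpansion psi ->
  uexpansion (fun t s => phi t s - psi t s).
Proof. by move=> H /uexpansionN; exact: uexpansionD. Qed.

Lemma uexpansionX phi n : uexpansion phi -> uexpansion (fun t s => phi t s ^+ n).
Proof.
move=> H; elim: n => [|n IH].
  by apply: uexpansion_ext (uexpansion_cst 1) => t s; rewrite expr0.
by apply: uexpansion_ext (uexpansionM H IH) => t s; rewrite exprS.
Qed.

Lemma uexpansion_sum n (phi : nat -> R -> R -> R) : (forall j, uexpansion (phi j)) ->
  uexpansion (fun t s => \sum_(j < n) phi j t s).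
Proof.
move=> H; elim: n => [|n IH].
  by apply: uexpansion_ext (uexpansion_cst 0) => t s; rewrite big_ord0.
by apply: uexpansion_ext (uexpansionD IH (H n)) => t s; rewrite big_ord_recr.
Qed.

End UniformExpansions.

Section NormalForm.
Variable R : realType.
Implicit Types (e : R) (phi psi h : R -> R -> R) (B : R -> R).

Lemma unifo_term e e' B : e < e' -> cont01 B -> unifo e (fun t s => t `^ e' * B s).
Proof.
move=> ee' /cont01_bounded[M M0 BM] eps eps0.
have e'e : 0 < e' - e by rewrite subr_gt0.
have /cvgr0Pnorm_le /(_ _ (divr_gt0 eps0 M0)) pw := powR_cvg0 e'e.
near=> t => s /BM Bs.
have t0 : 0 < t by near: t; exact: nbhs_right_gt.
have pt : t `^ (e' - e) <= eps / M.
  by apply: le_trans (ler_norm _) _; near: t.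
have -> : t `^ e' = t `^ (e' - e) * t `^ e.
  by rewrite -powRD ?subrK// (gt_eqF t0) implybT.
rewrite !normrM (ger0_norm (powR_ge0 _ _)) (ger0_norm (powR_ge0 _ _)) mulrAC.
rewrite ler_wpM2r ?powR_ge0//.
by rewrite -(divfK (lt0r_neq0 M0) eps) ler_pM ?powR_ge0.
Unshelve. all: by end_near. Qed.

Lemma unifo_sum e (I : finType) (P : pred I) (h : I -> R -> R -> R) :
  (forall i, P i -> unifo e (h i)) -> unifo e (fun t s => \sum_(i | P i) h i t s).
Proof.
move=> hu; elim: (index_enum I) => [|i r IH].
  by apply: unifo0 => t s _; rewrite big_nil.
have [Pi|nPi] := boolP (P i).
  by apply: unifo_ext (unifoD (hu i Pi) IH) => t s; rewrite big_cons Pi.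
by apply: unifo_ext IH => t s; rewrite big_cons (negPf nPi).
Qed.

Lemma cont01_sum (I : finType) (P : pred I) (B : I -> R -> R) :
  (forall i, cont01 (B i)) -> cont01 (fun s => \sum_(i | P i) B i s).
Proof.
move=> cB s s01; elim: (index_enum I) => [|i r IH].
  rewrite (_ : (fun s => _) = fun=> 0); first exact: cst_continuous.
  by apply/funext => x; rewrite big_nil.
have [Pi|nPi] := boolP (P i).
  rewrite (_ : (fun s => _) = fun s => B i s + \sum_(i <- r | P i) B i s).
    by apply: continuousD; [exact: cB|exact: IH].
  by apply/funext => x; rewrite big_cons Pi.
rewrite (_ : (fun s => _) = fun s => \sum_(i <- r | P i) B i s); first exact: IH.
by apply/funext => x; rewrite big_cons (negPf nPi).
Qed.

(* Group the terms of least exponent: if their coefficients add up to zero on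
   [0, 1], these terms can be dropped. *)
Lemma uexpansion_normal phi : uexpansion phi ->
  unifo 1 phi \/
  exists e L s1, [/\ e <= 1, cont01 L, 0 <= s1 <= 1, L s1 != 0 &
    unifo e (fun t s => phi t s - t `^ e * L s)].
Proof.
move=> [I [e [B [e0 cB]]]].
have -> : (fun t s => phi t s - \sum_i t `^ e i * B i s) =
  (fun t s => phi t s - \sum_(i in [set: I]%SET) t `^ e i * B i s).
  by apply/funext => t; apply/funext => s; congr (_ - _); apply: eq_bigl => i; rewrite inE.
move: [set: I]%SET => A.
have [n] := ubnP #|A|; elim: n A => // n IH A An H.
have [A0|[i0 i0A]] := set_0Vmem A.
  by left; apply: unifo_ext H => t s; rewrite A0 big_set0 subr0.
have [i iA imin] := @Order.TotalTheory.arg_minP _ _ _ i0 (mem A) e i0A.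
have [ei1|ei1] := ltP 1 (e i).
  left; apply: unifo_ext (unifoD H (@unifo_sum 1 I (mem A) _ _)) => [t s|j jA].
    exact: subrK.
  by apply: unifo_term => //; rewrite (lt_le_trans ei1)// imin.
pose L s := \sum_(j in A | e j == e i) B j s.
have cL : cont01 L by exact: cont01_sum.
have split t s : \sum_(j in A) t `^ e j * B j s =
    t `^ e i * L s + \sum_(j in A | e j != e i) t `^ e j * B j s.
  rewrite (bigID (fun j => e j == e i)) /=; congr (_ + _).
  by rewrite mulr_sumr; apply: eq_bigr => j /andP[_ /eqP ->].
have [[s1 [s101 Ls1]]|nL] := pselect (exists s1, 0 <= s1 <= 1 /\ L s1 != 0).
  right; exists (e i), L, s1; split=> //.
  have H1 := @unifo_sum (e i) I [pred j | (j \in A) && (e j != e i)]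
    (fun j t s => t `^ e j * B j s).
  apply: unifo_ext (unifoD (unifo_le ei1 H) (H1 _)) => [t s|j /andP[jA jn]].
    by rewrite split /=; lra.
  by apply: unifo_term => //; rewrite lt_neqAle eq_sym jn imin.
apply: (IH (A :\: [set j | e j == e i])%SET).
  rewrite (@leq_trans #|A|)//; apply: proper_card; rewrite properE subsetDl /=.
  apply/subsetPn; exists i => //; rewrite !inE eqxx //.
apply: unifo_ext (unifoD H (@unifo0 R 1 (fun t s => t `^ e i * L s) _)) => [t s|t s s01].
  have -> : \sum_(j in (A :\: [set j | e j == e i])%SET) t `^ e j * B j s =
      \sum_(j in A | e j != e i) t `^ e j * B j s.
    by apply: eq_bigl => j; rewrite !inE andbC.
  by rewrite split; ring.
have [->|Ls] := eqVneq (L s) 0; first by rewrite mulr0.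
by case: nL; exists s.
Qed.

Lemma increment_ge (f df : R -> R) (m x y : R) : 0 <= x -> x <= y -> y <= 1 ->
  (forall s : R, 0 <= s <= 1 -> is_derive (s : R) 1 f (df s)) ->
  (forall s, x <= s <= y -> m <= df s) -> m * (y - x) <= f y - f x.
Proof.
move=> x0 xy y1 dfE mdf.
have dxy (s : R) : s \in `]x, y[ -> is_derive s 1 f (df s).
  rewrite in_itv /= => /andP[xs sy]; apply: dfE.
  by rewrite (le_trans x0 (ltW xs)) (le_trans (ltW sy) y1).
have cf : {within `[x, y], continuous f}.
  apply: derivable_within_continuous => s; rewrite in_itv /= => /andP[xs sy].
  suff [] : is_derive s 1 f (df s) by [].
  by apply: dfE; rewrite (le_trans x0 xs) (le_trans sy y1).
have [c cxy ->] := MVT_segment xy dxy cf.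
by rewrite ler_wpM2r ?subr_ge0// mdf// -in_itv.
Qed.

Lemma cont01_pos B s1 : cont01 B -> 0 <= s1 <= 1 -> 0 < B s1 ->
  exists eta c d, [/\ 0 < eta, 0 <= c, c < d, d <= 1 &
    forall s, c <= s <= d -> eta <= B s].
Proof.
move=> cB s101 B0; have := cB _ s101.
move=> /cvgrPdist_lt /(_ _ (divr_gt0 B0 (ltr0n _ 2))) /nbhs_ballP [r /= r0 hr].
have hB s : `|s1 - s| < r -> B s1 / 2 <= B s.
  by move=> /hr /=; rewrite ltr_norml => /andP[_]; lra.
have B2 : 0 < B s1 / 2 by lra.
have [rh|rh] := ltP (r / 2) (1 / 2).
  have [sh|sh] := ltP s1 (1 / 2).
    exists (B s1 / 2), s1, (s1 + r / 2); split; [lra|lra|lra|lra|].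
    by move=> s ss; apply: hB; rewrite ltr_norml; lra.
  exists (B s1 / 2), (s1 - r / 2), s1; split; [lra|lra|lra|lra|].
  by move=> s ss; apply: hB; rewrite ltr_norml; lra.
have [sh|sh] := ltP s1 (1 / 2).
  exists (B s1 / 2), s1, (s1 + 1 / 2); split; [lra|lra|lra|lra|].
  by move=> s ss; apply: hB; rewrite ltr_norml; lra.
exists (B s1 / 2), (s1 - 1 / 2), s1; split; [lra|lra|lra|lra|].
by move=> s ss; apply: hB; rewrite ltr_norml; lra.
Qed.

Definition negl (u : R -> R) :=
  forall eps, 0 < eps -> \forall t \near 0^'+, `|u t| <= eps * t.

Definition quasi_ge0 (u : R -> R) :=
  forall eps, 0 < eps -> \forall t \near 0^'+, - (eps * t) <= u t.

Lemma increment_quasi_ge0 (Phi phi : R -> R -> R) (h : R -> R) (C : R) :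
  uexpansion phi ->
  (\forall t \near 0^'+, 0 <= h t <= C) ->
  (\forall t \near 0^'+, forall s : R, 0 <= s <= 1 ->
    is_derive s 1 (Phi t) (h t * phi t s)) ->
  (forall s, 0 <= s <= 1 -> quasi_ge0 (phi ^~ s)) ->
  quasi_ge0 (fun t => Phi t 1 - Phi t 0).
Proof.
move=> /uexpansion_normal[phi0|[e [L [s1 [e1 cL s101 Ls1 HL]]]]] hC dPhi phige eps eps0.
  have C1 : 0 < `|C| + 1 by rewrite ltr_pwDr.
  near=> t.
  have /andP[t0 t1] : 0 < t <= 1 by near: t; exact: near0_itv01.
  have /andP[h0 hC1] : 0 <= h t <= C by near: t.
  have HP : forall s, 0 <= s <= 1 -> `|phi t s| <= eps / (`|C| + 1) * t `^ 1.
    by near: t; apply: phi0; rewrite divr_gt0.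
  have dP : forall s : R, 0 <= s <= 1 -> is_derive (s : R) 1 (Phi t) (h t * phi t s) by near: t.
  have := @increment_ge (Phi t) (fun s => h t * phi t s) (- (eps * t)) 0 1
     (lexx 0) ler01 (lexx 1) dP.
  rewrite subr0 mulr1; apply => s /HP; rewrite powRr1 ?(ltW t0)// => ps.
  apply: le_trans (_ : - `|h t * phi t s| <= _); last by rewrite lerNl -normrN ler_norm.
  rewrite lerN2 normrM ger0_norm//.
  apply: le_trans (ler_pM _ _ (_ : h t <= `|C| + 1) ps) _ => //.
    by rewrite (le_trans hC1)// (le_trans (ler_norm _))// lerDl.
  by rewrite le_eqVlt; apply/orP; left; apply/eqP; field; rewrite gt_eqF.
have L0 s : 0 <= s <= 1 -> 0 <= L s.
  move=> s01; rewrite leNgt; apply/negP => Lneg.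
  have L4 : 0 < - L s / 4 by lra.
  near (0:R)^'+ => t.
  have /andP[t0 t1] : 0 < t <= 1 by near: t; exact: near0_itv01.
  have : - (- L s / 4 * t) <= phi t s by near: t; exact: phige.
  have : forall r, 0 <= r <= 1 -> `|phi t r - t `^ e * L r| <= - L s / 4 * t `^ e.
    by near: t; exact: HL.
  move=> /(_ s s01).
  have te : t <= t `^ e by rewrite ger1_powR// t0.
  have p0 : 0 < t `^ e by exact: powR_gt0.
  rewrite ler_norml => /andP[_ H1] H2.
  have H3 : - L s / 4 * t <= - L s / 4 * t `^ e by rewrite ler_pM2l.
  have H4 : 0 < (- L s) * t `^ e by rewrite mulr_gt0// oppr_gt0.
  lra.
have [] := @cont01_pos L s1 cL s101; first by rewrite lt_neqAle eq_sym Ls1 L0.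
move=> eta [c [d [eta0 c0 cd d1 Leta]]].
have ed : 0 < eta * (d - c) by rewrite mulr_gt0// subr_gt0.
near=> t.
have /andP[t0 t1] : 0 < t <= 1 by near: t; exact: near0_itv01.
have /andP[h0 hC1] : 0 <= h t <= C by near: t.
have HP : forall s, 0 <= s <= 1 -> `|phi t s - t `^ e * L s| <= eta * (d - c) * t `^ e.
  by near: t; exact: HL.
have dP : forall s : R, 0 <= s <= 1 -> is_derive (s : R) 1 (Phi t) (h t * phi t s) by near: t.
have p0 : 0 <= t `^ e by exact: powR_ge0.
have lb m s : 0 <= s <= 1 -> m <= L s -> h t * (t `^ e * (m - eta * (d - c))) <= h t * phi t s.
  move=> s01 mL; rewrite ler_wpM2l//.
  have := HP s s01; rewrite ler_norml => /andP[H1 _].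
  have := ler_wpM2l p0 mL; lra.
have I1 := @increment_ge (Phi t) _ (h t * (t `^ e * (0 - eta * (d - c)))) 0 c
  (lexx 0) c0 ltac:(lra) dP.
have I2 := @increment_ge (Phi t) _ (h t * (t `^ e * (eta - eta * (d - c)))) c d
  c0 (ltW cd) d1 dP.
have I3 := @increment_ge (Phi t) _ (h t * (t `^ e * (0 - eta * (d - c)))) d 1
  ltac:(lra) d1 (lexx 1) dP.
have {}I1 := I1 (fun s ss => lb 0 s ltac:(lra) (L0 s ltac:(lra))).
have {}I2 := I2 (fun s ss => lb eta s ltac:(lra) (Leta s ss)).
have {}I3 := I3 (fun s ss => lb 0 s ltac:(lra) (L0 s ltac:(lra))).
have : 0 <= Phi t 1 - Phi t 0.
  have -> : Phi t 1 - Phi t 0 =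
    (Phi t c - Phi t 0) + (Phi t d - Phi t c) + (Phi t 1 - Phi t d) by ring.
  apply: le_trans (lerD (lerD I1 I2) I3).
  have -> : h t * (t `^ e * (0 - eta * (d - c))) * (c - 0) +
    h t * (t `^ e * (eta - eta * (d - c))) * (d - c) +
    h t * (t `^ e * (0 - eta * (d - c))) * (1 - d) = 0 by ring.
  by [].
by apply: le_trans; rewrite oppr_le0 mulr_ge0 ?ltW.
Unshelve. all: by end_near. Qed.

Lemma increment_not_negl (Phi phi : R -> R -> R) e L s1 :
  e <= 1 -> cont01 L -> 0 <= s1 <= 1 -> 0 < L s1 ->
  unifo e (fun t s => phi t s - t `^ e * L s) ->
  (\forall t \near 0^'+, forall s : R, 0 <= s <= 1 -> is_derive (s : R) 1 (Phi t) (phi t s)) ->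
  ~ (forall s, 0 <= s <= 1 -> negl (Phi ^~ s)).
Proof.
move=> e1 cL s101 Ls1 HL dPhi Phi0.
have [eta [c [d [eta0 c0 cd d1 Leta]]]] := cont01_pos cL s101 Ls1.
have ed : 0 < eta * (d - c) by rewrite mulr_gt0// subr_gt0.
near (0:R)^'+ => t.
have /andP[t0 t1] : 0 < t <= 1 by near: t; exact: near0_itv01.
have HP : forall s, 0 <= s <= 1 -> `|phi t s - t `^ e * L s| <= eta / 2 * t `^ e.
  by near: t; apply: HL; lra.
have dP : forall s : R, 0 <= s <= 1 -> is_derive (s : R) 1 (Phi t) (phi t s) by near: t.
have p0 : 0 <= t `^ e by exact: powR_ge0.
have := @increment_ge (Phi t) _ (t `^ e * (eta / 2)) c d c0 (ltW cd) d1 dP.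
have Hc : `|Phi t c| <= eta * (d - c) / 8 * t by near: t; apply: Phi0; lra.
have Hd : `|Phi t d| <= eta * (d - c) / 8 * t by near: t; apply: Phi0; lra.
move: Hc Hd; rewrite !ler_norml => /andP[Hc _] /andP[_ Hd].
have te : t <= t `^ e by rewrite ger1_powR// t0.
have H3 : eta * (d - c) / 8 * t <= eta * (d - c) / 8 * t `^ e by rewrite ler_pM2l//; lra.
have H4 : 0 < eta * (d - c) * t `^ e by rewrite mulr_gt0// powR_gt0.
move=> H; have {}H : t `^ e * (eta / 2) * (d - c) <= Phi t d - Phi t c.
  apply: H => s ss; have /HP : 0 <= s <= 1 by lra.
  rewrite ler_norml => /andP[H1 _]; have := ler_wpM2l p0 (Leta s ss); lra.
have H5 : t `^ e * (eta / 2) * (d - c) = eta * (d - c) * t `^ e / 2 by ring.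
lra.
Unshelve. all: by end_near. Qed.

Lemma derivative_negl (Phi phi : R -> R -> R) : uexpansion phi ->
  (\forall t \near 0^'+, forall s : R, 0 <= s <= 1 -> is_derive (s : R) 1 (Phi t) (phi t s)) ->
  (forall s, 0 <= s <= 1 -> negl (Phi ^~ s)) ->
  forall s, 0 <= s <= 1 -> negl (phi ^~ s).
Proof.
move=> /uexpansion_normal[phi0|[e [L [s1 [e1 cL s101 Ls1 HL]]]]] dPhi Phi0 s s01.
  move=> eps eps0; near=> t.
  have /andP[t0 _] : 0 < t <= 1 by near: t; exact: near0_itv01.
  have : forall r, 0 <= r <= 1 -> `|phi t r| <= eps * t `^ 1 by near: t; exact: phi0.
  by move=> /(_ s s01); rewrite powRr1// ltW.
exfalso; have [Lpos|Lneg] := ltP 0 (L s1).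
  exact: (increment_not_negl e1 cL s101 Lpos HL dPhi).
apply: (@increment_not_negl (fun t s => - Phi t s) (fun t s => - phi t s) e
  (fun s => - L s) s1) => //.
- by move=> r r01; apply: continuousN; exact: cL.
- by rewrite oppr_gt0 lt_neqAle Ls1 Lneg.
- move=> eps eps0; apply: filterS (HL eps eps0) => t Ht r /Ht.
  by rewrite -normrN; congr (`| _ | <= _); ring.
- by apply: filterS dPhi => t Ht r /Ht ?; exact: is_deriveN.
- move=> r r01 eps eps0; apply: filterS (Phi0 r r01 eps eps0) => t.
  by rewrite normrN.
Unshelve. all: by end_near. Qed.

End NormalForm.

(** * Smooth functions of expansions *)

Section Composition.
Variable R : realType.

Lemma mvt_abs (f df : R -> R) (r K w : R) :
  (forall s : R, `|s| <= r -> is_derive (s : R) 1 f (df s)) ->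
  (forall s, `|s| <= r -> `|df s| <= K) ->
  `|w| <= r -> `|f w - f 0| <= K * `|w|.
Proof.
move=> dfE dfK wr.
have main (x y : R) : x <= y -> - r <= x -> y <= r -> `|f y - f x| <= K * (y - x).
  move=> xy rx yr.
  have inr (s : R) : x <= s <= y -> `|s| <= r.
    by move=> /andP[xs sy]; rewrite ler_norml (le_trans rx xs) (le_trans sy yr).
  have [c cxy ->] : exists2 c, c \in `[x, y] & f y - f x = df c * (y - x).
    apply: MVT_segment xy _ _ => [s|].
      by rewrite in_itv /= => /andP[xs sy]; apply/dfE/inr; rewrite !ltW.
    apply: derivable_within_continuous => s; rewrite in_itv /= => /inr /dfE ds.
    exact: ex_derive.
  by rewrite normrM (ger0_norm (_ : 0 <= y - x)) ?ler_wpM2r ?subr_ge0// dfK// inr.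
move: wr; rewrite ler_norml => /andP[rw wr].
have [w0|w0] := leP 0 w.
  by have := main 0 w w0; rewrite subr0 (ger0_norm w0); apply; lra.
by have := main w 0 (ltW w0); rewrite sub0r distrC (ltr0_norm w0); apply; lra.
Qed.

Lemma is_derive_taylor_poly N (c : nat -> R) (s : R) :
  is_derive s 1 (fun x : R => \sum_(j < N.+1) c j * x ^+ j / j`!%:R)
    (\sum_(j < N) c j.+1 * s ^+ j / j`!%:R).
Proof.
elim: N => [|N IH].
  rewrite big_ord0 (_ : (fun x : R => _) = cst (c 0%N)); first exact: is_derive_cst.
  by apply/funext => x; rewrite big_ord_recr big_ord0 /= add0r expr0 mulr1 divr1.
rewrite big_ord_recr /=.
have H : is_derive s 1 (fun x : R => (c N.+1 / N.+1`!%:R) *: (id ^+ N.+1) x)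
    (c N.+1 * s ^+ N / N`!%:R).
  apply: is_derive_eq; rewrite /= /GRing.scale /= mulr1 factS natrM.
  have N0 : N.+1%:R != 0 :> R by rewrite pnatr_eq0.
  have NF : N`!%:R != 0 :> R by rewrite pnatr_eq0 -lt0n fact_gt0.
  by move: (N.+1%:R : R) (N`!%:R : R) N0 NF => u v u0 v0; field; rewrite u0 v0.
have := is_deriveD IH H.
congr (is_derive _ _ _ _); apply/funext => x.
rewrite [RHS]big_ord_recr /=; congr (_ + _).
have -> : (id ^+ N.+1 : R -> R) x = x ^+ N.+1.
  by elim: (N.+1) => [|k IHk]; rewrite ?expr0// !exprS -IHk.
by rewrite /= /GRing.scale /=; ring.
Qed.

Lemma taylor_bound N (F : nat -> R -> R) (r M w : R) :
  (forall j (s : R), (j < N)%N -> `|s| <= r -> is_derive (s : R) 1 (F j) (F j.+1 s)) ->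
  (forall s, `|s| <= r -> `|F N s| <= M) ->
  `|w| <= r ->
  `|F 0%N w - \sum_(j < N) F j 0 * w ^+ j / j`!%:R| <= M * `|w| ^+ N.
Proof.
elim: N F r w => [|N IH] F r w dF FM wr.
  by rewrite big_ord0 subr0 expr0 mulr1 FM.
pose p x := \sum_(j < N.+1) F j 0 * x ^+ j / j`!%:R.
pose q x := \sum_(j < N) F j.+1 0 * x ^+ j / j`!%:R.
have dg (s : R) : `|s| <= `|w| -> is_derive s 1 (fun x => F 0%N x - p x) (F 1%N s - q s).
  move=> sw; apply: is_deriveB; last exact: (is_derive_taylor_poly N (F ^~ 0)).
  by apply: dF => //; exact: le_trans sw wr.
have M0 : 0 <= M by rewrite (le_trans _ (FM w wr)).
have gM s : `|s| <= `|w| -> `|F 1%N s - q s| <= M * `|w| ^+ N.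
  move=> sw; apply: (@le_trans _ _ (M * `|s| ^+ N)).
    apply: (IH (fun j => F j.+1) r) => [j x jN xr|x xr|].
    - exact: dF.
    - exact: FM.
    - exact: le_trans sw wr.
  by rewrite ler_wpM2l// lerXn2r ?nnegrE.
have := mvt_abs dg gM (lexx _).
suff -> : F 0%N 0 - p 0 = 0 by rewrite subr0 -mulrA -exprSr.
rewrite /p big_ord_recl /= expr0 mulr1 divr1 big1 ?addr0 ?subrr// => i _.
by rewrite expr0n /= mulr0 mul0r.
Qed.

Lemma line_derive n (G : 'rV[R]_n -> R) (z v : 'rV[R]_n) (s : R) :
  derivable G (z + s *: v) v ->
  is_derive s 1 (fun x : R => G (z + x *: v)) ('D_v G (z + s *: v)).
Proof.
move=> dG.
have E : (fun h : R => h^-1 *: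
      (((fun x : R => G (z + x *: v)) \o shift s) (h *: 1) - G (z + s *: v)))
   = (fun h : R => h^-1 *: ((G \o shift (z + s *: v)) (h *: v) - G (z + s *: v))).
  apply/funext => h /=; congr (_ *: (G _ - _)).
  by rewrite scalerDl /GRing.scale /= mulr1 addrCA.
by apply: DeriveDef; rewrite /derivable /derive E.
Qed.

Definition box n (c : 'rV[R]_n) (r : R) : set 'rV[R]_n :=
  [set z | forall i, `|z 0 i - c 0 i| <= r].

Lemma box_bounded n (c : 'rV[R]_n) r (G : 'rV[R]_n -> R) :
  (forall z, box c r z -> {for z, continuous G}) ->
  exists2 M, 0 < M & forall z, box c r z -> `|G z| <= M.
Proof.
move=> cG.
have cb : compact (box c r).
  have := @rV_compact _ n (fun i => `[c 0 i - r, c 0 i + r]%classic)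
     (fun i => @segment_compact _ _ _).
  rewrite (_ : mkset _ = box c r)//; apply/seteqP; split => z /= H i; move: (H i);
  by rewrite /= in_itv /= ler_distl.
have : compact (G @` box c r).
  apply: continuous_compact cb.
  by apply: continuous_in_subspaceT => s; rewrite inE; exact: cG.
move=> /compact_bounded [M [_ hM]].
exists (`|M| + 1) => [|s s01]; first by rewrite ltr_pwDr.
apply: (hM (`|M| + 1)); first by rewrite (le_lt_trans (ler_norm M))// ltrDl.
by exists s.
Qed.

Lemma CinfD n (U : set 'rV[R]_n) G i : Cinf U G ->
  Cinf U (fun z => 'D_(delta_mx 0 i) G z).
Proof. by move=> CG k; have [_ /(_ i)[]] := CG k.+1. Qed.

Definition pderiv n (i : 'I_n) (j : nat) (G : 'rV[R]_n -> R) :=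
  iter j (fun G z => 'D_(delta_mx 0 i) G z) G.

Lemma Cinf_pderiv n (U : set 'rV[R]_n) G i j : Cinf U G -> Cinf U (pderiv i j G).
Proof. by move=> CG; elim: j => //= j; exact: CinfD. Qed.

Lemma Cinf_continuous n (U : set 'rV[R]_n) G z : Cinf U G -> U z -> {for z, continuous G}.
Proof. by move=> /(_ 0%N); exact. Qed.

Lemma Cinf_derivable n (U : set 'rV[R]_n) G i z : Cinf U G -> U z ->
  derivable G z (delta_mx 0 i).
Proof. by move=> /(_ 1%N)[_ /(_ i)[H _]]; exact: H. Qed.

Lemma Cinf_taylor n (U : set 'rV[R]_n) G i (z : 'rV[R]_n) (M w : R) N : Cinf U G ->
  (forall x, `|x| <= `|w| -> U (z + x *: delta_mx 0 i)) ->
  (forall x, `|x| <= `|w| -> `|pderiv i N G (z + x *: delta_mx 0 i)| <= M) ->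
  `|G (z + w *: delta_mx 0 i) - \sum_(j < N) pderiv i j G z * w ^+ j / j`!%:R|
    <= M * `|w| ^+ N.
Proof.
move=> CG Uz bz.
have := @taylor_bound N (fun j x => pderiv i j G (z + x *: delta_mx 0 i)) `|w| M w _ bz (lexx _).
rewrite scale0r addr0; apply => j s _ sw.
apply: line_derive; apply: Cinf_derivable (Uz s sw); exact: Cinf_pderiv.
Qed.

Definition upower (h : R -> R -> R) := exists e C, 0 < e /\
  \forall t \near 0^'+, forall s, 0 <= s <= 1 -> `|h t s| <= C * t `^ e.

Lemma upower_small h eps : upower h -> 0 < eps ->
  \forall t \near 0^'+, forall s, 0 <= s <= 1 -> `|h t s| <= eps.
Proof.
move=> [e [C [e0 hC]]] eps0.
have := @unifo_term R 0 e (fun=> C) e0 (@cont01_cst _ C) eps eps0.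
apply: filterS2 hC => t ht Ct s s01; apply: le_trans (ht s s01) _.
by rewrite mulrC (le_trans (ler_norm _))// (le_trans (Ct s s01))// powRr0 mulr1.
Qed.

Lemma upower_exp h : upower h -> exists N, unifo 1 (fun t s => h t s ^+ N).
Proof.
move=> [e [C [e0 hC]]].
have [N eN] : exists N : nat, 1 < e * N%:R.
  exists (Num.truncn (e^-1)).+1; rewrite -ltr_pdivrMl// mulr1.
  by rewrite truncnS_gt.
exists N => eps eps0.
have := @unifo_term R 1 (e * N%:R) (fun=> C ^+ N) eN (@cont01_cst _ _) eps eps0.
apply: filterS2 hC => t ht Ct s s01; apply: le_trans (Ct s s01).
rewrite powRrM powR_mulrn ?powR_ge0// -exprMn [_ * C]mulrC !normrX lerXn2r ?nnegrE//.
by rewrite (le_trans (ht s s01)) ?ler_norm.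
Qed.

Lemma cvg_row n (T : Type) (F : set_system T) {FF : Filter F} (f : T -> 'rV[R]_n) (l : 'rV[R]_n) :
  (forall i, f x 0 i @[x --> F] --> l 0 i) -> f x @[x --> F] --> l.
Proof.
move=> H; apply/cvgrPdist_le => eps eps0.
have : \forall x \near F, forall i, `|l 0 i - f x 0 i| <= eps.
  by apply: filter_forall => i; have /cvgrPdist_le := H i; apply.
apply: filterS => x Hx; rewrite [X in X <= _]/Num.norm /= mx_normrE.
apply/bigmax_leP; split => [|[a b] _]; first exact: ltW.
by rewrite /= !mxE !ord1; exact: Hx.
Qed.

(* Perturbing one coordinate at a time only involves iterated partial derivatives
   in a single direction: neither the chain rule nor Schwarz's theorem is needed. *)
Lemma uexpansion_comp n (U : set 'rV[R]_n) G c r (z0 : R -> 'rV[R]_n) (w : R -> R -> 'rV[R]_n) :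
  0 < r -> Cinf U G -> box c r `<=` U ->
  (forall i, cont01 (fun s => z0 s 0 i)) ->
  (forall s, 0 <= s <= 1 -> box c (r / 2) (z0 s)) ->
  (forall i, uexpansion (fun t s => w t s 0 i)) ->
  (forall i, upower (fun t s => w t s 0 i)) ->
  uexpansion (fun t s => G (z0 s + w t s)).
Proof.
move=> r0 CG bU cz0 bz0 uw pw.
pose z m t s := z0 s + \row_j (if (j < m)%N then w t s 0 j else 0).
suff H m : (m <= n)%N -> forall G, Cinf U G -> uexpansion (fun t s => G (z m t s)).
  apply: uexpansion_ext (H n (leqnn n) G CG) => t s; congr (G (_ + _)).
  by apply/rowP => j; rewrite mxE ltn_ord.
elim: m => [_|m IH mn] {CG} G CG.
  apply: (@uexpansion_ext _ (fun t s => G (z0 s))) => [t s|].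
    by congr (G _); rewrite /z -[LHS]addr0; congr (_ + _); apply/rowP => j; rewrite !mxE.
  apply: uexpansion_coef => s s01.
  apply: (@continuous_comp _ _ _ z0 G).
    by apply: cvg_row => i; exact: cz0.
  apply: (Cinf_continuous CG); apply: bU => i; have := bz0 s s01 i; lra.
pose i : 'I_n := Ordinal mn.
have [N HN] := upower_exp (pw i).
have [M M0 HM] : exists2 M, 0 < M & forall z, box c r z -> `|pderiv i N G z| <= M.
  apply: box_bounded => x /bU; apply: Cinf_continuous; exact: Cinf_pderiv.
have U1 : uexpansion (fun t s => \sum_(j < N) pderiv i j G (z m t s) * w t s 0 i ^+ j / j`!%:R).
  apply: (@uexpansion_sum _ N (fun j t s => pderiv i j G (z m t s) * w t s 0 i ^+ j / j`!%:R)) => j.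
  apply: uexpansionM (uexpansion_cst _); apply: uexpansionM; last exact/uexpansionX/uw.
  apply: IH; [exact: ltnW|exact: Cinf_pderiv].
apply: uexpansion_unifo U1 _.
have zS t s : z m.+1 t s = z m t s + w t s 0 i *: delta_mx 0 i.
  rewrite /z -addrA; congr (_ + _); apply/rowP => j; rewrite !mxE eqxx /= ltnS leq_eqVlt.
  have -> : (j == i) = (j == m :> nat) by [].
  have [jm|jm] := eqVneq (j : nat) m; last by rewrite mulr0 addr0.
  rewrite jm ltnn mulr1 add0r; congr (w t s 0 _); exact: val_inj.
have := unifoMl (ubounded_term (lexx 0) (@cont01_cst R M)) HN.
move=> HMN eps eps0; have {}HMN := HMN eps eps0.
have small : \forall t \near 0^'+, forall k : 'I_n, forall s, 0 <= s <= 1 -> `|w t s 0 k| <= r / 2.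
  by apply: filter_forall => k; apply: upower_small (pw k) _; rewrite divr_gt0.
apply: filterS2 small HMN => t ht HMN s s01.
have inb x : `|x| <= `|w t s 0 i| -> box c r (z m t s + x *: delta_mx 0 i).
  move=> xw k; rewrite !mxE eqxx /=.
  have := bz0 s s01 k; have wk := ht k s s01.
  have xk := le_trans xw (ht i s s01).
  have [ki|ki] := eqVneq k i; last first.
    by case: ifP => _ zk; move: wk xk zk; rewrite mulr0 addr0 !ler_norml; lra.
  by rewrite ki ltnn mulr1 addr0; move: xk; rewrite !ler_norml; lra.
rewrite zS; apply: le_trans (HMN s s01); rewrite powRr0 mul1r normrM normrX (gtr0_norm M0).
by apply: (Cinf_taylor CG) => x xw; [apply/bU/inb|apply/HM/inb].
Qed.

Lemma Cinf_lipschitz n (U : set 'rV[R]_n) G c r : 0 < r -> Cinf U G -> box c r `<=` U ->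
  exists M : 'I_n -> R, forall z z' : 'rV[R]_n, box c (r / 2) z ->
    (forall i, `|z' 0 i - z 0 i| <= r / 2) ->
    `|G z' - G z| <= \sum_i M i * `|z' 0 i - z 0 i|.
Proof.
move=> r0 CG bU.
have HM i : {M | 0 < M & forall z, box c r z -> `|pderiv i 1 G z| <= M}.
  apply: cid2; apply: box_bounded => x /bU; apply: Cinf_continuous; exact: Cinf_pderiv.
exists (fun i => s2val (HM i)) => z z' bz zz'.
pose y m := \row_j (if (j < m)%N then z' 0 j else z 0 j).
suff H m : (m <= n)%N ->
    `|G (y m) - G z| <= \sum_(i < n | (i < m)%N) s2val (HM i) * `|z' 0 i - z 0 i|.
  have := H n (leqnn n); rewrite (_ : y n = z').
    by rewrite (eq_bigl xpredT) => // i; rewrite ltn_ord.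
  by apply/rowP => j; rewrite mxE ltn_ord.
elim: m => [_|m IH mn].
  rewrite big_pred0// (_ : y 0%N = z) ?subrr ?normr0//.
  by apply/rowP => j; rewrite mxE.
pose i : 'I_n := Ordinal mn.
have yS : y m.+1 = y m + (z' 0 i - z 0 i) *: delta_mx 0 i.
  apply/rowP => j; rewrite !mxE eqxx /= ltnS leq_eqVlt.
  have -> : (j == i) = (j == m :> nat) by [].
  have [jm|jm] := eqVneq (j : nat) m; last by rewrite mulr0 addr0.
  by rewrite jm ltnn mulr1 (_ : j = i) ?subrKC//; exact: val_inj.
rewrite (bigD1 i) ?leqnn//=.
rewrite (eq_bigl (fun j : 'I_n => (j < m)%N)); last first.
  move=> j; rewrite ltnS leq_eqVlt.
  have -> : (j == i) = (j == m :> nat) by [].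
  by have [->|] := eqVneq (j : nat) m; rewrite ?ltnn ?andbT.
rewrite -(subrK (G (y m)) (G _)) -addrA; apply: le_trans (ler_normD _ _) _.
apply: lerD (IH (ltnW mn)); rewrite yS.
have inb x : `|x| <= `|z' 0 i - z 0 i| -> box c r (y m + x *: delta_mx 0 i).
  move=> xw k; rewrite !mxE eqxx /=.
  have zk := bz k; have wk := zz' k; have xk := le_trans xw (zz' i).
  have [ki|ki] := eqVneq k i; last first.
    by case: ifP => _; move: wk xk zk; rewrite mulr0 addr0 !ler_norml; lra.
  by rewrite ki ltnn mulr1; move: zk xk; rewrite ki !ler_norml; lra.
have := @Cinf_taylor n U G i (y m) (s2val (HM i)) (z' 0 i - z 0 i) 1 CG.
rewrite big_ord1 /= expr0 mulr1 divr1 expr1; apply => x xw; first exact/bU/inb.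
by case: (HM i) => M _ /= HMi; exact/HMi/inb.
Qed.

End Composition.

(** * Fermat reals *)

Section FermatReals.
Variable R : realType.
Implicit Types (x y z u v : R -> R) (X Y Z : FR R).

Lemma negl_ext u v : u =1 v -> negl u -> negl v.
Proof. by move=> /funext ->. Qed.

Lemma neglD u v : negl u -> negl v -> negl (fun t => u t + v t).
Proof.
move=> Hu Hv eps eps0; have e2 : 0 < eps / 2 by rewrite divr_gt0.
apply: filterS2 (Hu _ e2) (Hv _ e2) => t ut vt.
by apply: le_trans (ler_normD _ _) _; lra.
Qed.

Lemma neglZ (c : R) u : negl u -> negl (fun t => c * u t).
Proof.
move=> Hu eps eps0; have c1 : 0 < `|c| + 1 by rewrite ltr_pwDr.
near=> t; have ut : `|u t| <= eps / (`|c| + 1) * t.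
  by near: t; apply: Hu; rewrite divr_gt0.
rewrite normrM; apply: (@le_trans _ _ ((`|c| + 1) * `|u t|)).
  by rewrite ler_wpM2r// lerDl.
rewrite -(ler_pdivlMl _ _ c1); apply: le_trans ut _.
by rewrite le_eqVlt; apply/orP; left; apply/eqP; ring.
Unshelve. all: by end_near. Qed.

Lemma neglB u v : negl u -> negl v -> negl (fun t => u t - v t).
Proof.
by move=> Hu /(neglZ (-1)) /(neglD Hu); apply: negl_ext => t; rewrite mulN1r.
Qed.

Lemma quasi_ge0D u v : quasi_ge0 u -> quasi_ge0 v -> quasi_ge0 (fun t => u t + v t).
Proof.
move=> Hu Hv eps eps0; have e2 : 0 < eps / 2 by rewrite divr_gt0.
by apply: filterS2 (Hu _ e2) (Hv _ e2) => t ut vt; lra.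
Qed.

Lemma quasi_ge0_ext u v : u =1 v -> quasi_ge0 u -> quasi_ge0 v.
Proof. by move=> /funext ->. Qed.

Lemma negl_quasi_ge0 u : negl u -> quasi_ge0 u.
Proof.
move=> Hu eps eps0; apply: filterS (Hu _ eps0) => t.
by rewrite ler_norml => /andP[].
Qed.

Lemma quasi_ge0_negl u v : quasi_ge0 u -> negl (fun t => v t - u t) -> quasi_ge0 v.
Proof.
by move=> Hu /negl_quasi_ge0 /(quasi_ge0D Hu); apply: quasi_ge0_ext => t; rewrite subrKC.
Qed.

Lemma quasi_ge0_near u : (\forall t \near 0^'+, 0 <= u t) -> quasi_ge0 u.
Proof.
move=> H eps eps0; apply: filterS2 H (near0_itv01 R) => t ut /andP[t0 _].
by rewrite (le_trans _ ut)// oppr_le0 mulr_ge0 ?ltW.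
Qed.

Lemma littleo_tP u : littleo_t u <-> u 0 = 0 /\ negl u.
Proof.
split=> -[u0 H]; split=> //.
  move=> eps eps0; have /cvgr0Pnorm_le /(_ _ eps0) := H.
  apply: filterS2 (near0_itv01 R) => t /andP[t0 _].
  by rewrite normrM normfV (gtr0_norm t0) ler_pdivrMr.
apply/cvgr0Pnorm_le => eps eps0; have := H _ eps0.
apply: filterS2 (near0_itv01 R) => t /andP[t0 _].
by rewrite normrM normfV (gtr0_norm t0) ler_pdivrMr.
Qed.

Lemma fsimP x y : fsim x y <-> x 0 = y 0 /\ negl (fun t => x t - y t).
Proof.
rewrite /fsim littleo_tP; split=> -[H1 H2]; split=> //; first exact/subr0_eq.
by rewrite H1 subrr.
Qed.

Lemma fsim_refl x : fsim x x.
Proof.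
apply/fsimP; split=> // eps eps0; apply: filterS (near0_itv01 R) => t /andP[t0 _].
by rewrite subrr normr0 mulr_ge0 ?ltW.
Qed.

Lemma fsim_sym x y : fsim x y -> fsim y x.
Proof.
move=> /fsimP[H1 /(neglZ (-1)) H2]; apply/fsimP; split=> //.
by apply: negl_ext H2 => t; ring.
Qed.

Lemma fsim_trans x y z : fsim x y -> fsim y z -> fsim x z.
Proof.
move=> /fsimP[H1 H2] /fsimP[H3 H4]; apply/fsimP; split; first exact: etrans H1 H3.
by apply: negl_ext (neglD H2 H4) => t; ring.
Qed.

Lemma Rot_fsim x y : Rot x -> fsim x y -> Rot y.
Proof.
move=> [k [r [al [a [a0 H]]]]] xy; exists k, r, al, a; split=> //.
pose p t := r + \sum_(i < k) al i * t `^ a i.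
exact: (fsim_trans (y := x) (z := p) (fsim_sym xy)).
Qed.

Lemma Rot_cst (c : R) : Rot (fun=> c).
Proof.
exists 0%N, c, (fun=> 0), (fun=> 0); split=> //.
have := fsim_refl (fun=> c); rewrite /fsim; congr littleo_t.
by apply/funext => t; rewrite big_ord0 addr0.
Qed.

Lemma RotD x y : Rot x -> Rot y -> Rot (fun t => x t + y t).
Proof.
move=> [k [r [al [a [a0 /littleo_tP[H1 H2]]]]]] [k' [r' [al' [a' [a'0 /littleo_tP[H1' H2']]]]]].
exists (k + k')%N, (r + r'),
  (fun i : 'I_(k + k') => match fintype.split i with inl j => al j | inr j => al' j end),
  (fun i : 'I_(k + k') => match fintype.split i with inl j => a j | inr j => a' j end).
split=> [i|]; first by case: (fintype.split i).
have E t : r + r' + \sum_(i < k + k')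
    match fintype.split i with inl j => al j | inr j => al' j end *
    t `^ match fintype.split i with inl j => a j | inr j => a' j end =
  (r + \sum_(i < k) al i * t `^ a i) + (r' + \sum_(i < k') al' i * t `^ a' i).
  rewrite big_split_ord /= addrACA; congr (_ + _ + (_ + _)).
    by apply: eq_bigr => i _; rewrite (unsplitK (inl i)).
  by apply: eq_bigr => i _; rewrite (unsplitK (inr i)).
apply/littleo_tP; rewrite E; split; first by lra.
by apply: negl_ext (neglD H2 H2') => t; rewrite E; ring.
Qed.

Lemma RotZ (c : R) x : Rot x -> Rot (fun t => c * x t).
Proof.
move=> [k [r [al [a [a0 /littleo_tP[H1 H2]]]]]].
exists k, (c * r), (fun i => c * al i), a; split=> //.
have E t : c * r + \sum_(i < k) c * al i * t `^ a i =
    c * (r + \sum_(i < k) al i * t `^ a i).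
  by rewrite mulrDr mulr_sumr; congr (_ + _); apply: eq_bigr => i _; rewrite mulrA.
apply/littleo_tP; rewrite E -mulrBr H1 mulr0; split=> //.
by apply: negl_ext (neglZ c H2) => t; rewrite E mulrBr.
Qed.

Lemma RotB x y : Rot x -> Rot y -> Rot (fun t => x t - y t).
Proof.
move=> Hx /(RotZ (-1)) /(RotD Hx); congr Rot.
by apply/funext => t; rewrite mulN1r.
Qed.

(* As [t `^ 0 = 1] even for [t = 0], the terms with [a i = 0] cancel in [x t - x 0]. *)
Lemma Rot_expansion x : Rot x -> exists k (b a : 'I_k -> R),
  (forall i, 0 <= a i) /\ (forall i, a i = 0 -> b i = 0) /\
  unifo 1 (fun t _ => (x t - x 0) - \sum_i t `^ a i * b i).
Proof.
move=> [k [r [al [a [a0 /littleo_tP[H1 H2]]]]]].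
exists k, (fun i => if a i == 0 then 0 else al i), a; split=> //; split.
  by move=> i ->; rewrite eqxx.
move=> eps eps0; apply: filterS2 (near0_itv01 R) (H2 _ eps0) => t /andP[t0 _] Ht s _.
rewrite (powRr1 (ltW t0)); apply: le_trans Ht; rewrite le_eqVlt; apply/orP; left.
apply/eqP; congr (`| _ |).
have -> : x 0 = r + \sum_(i < k) al i * 0 `^ a i by exact/subr0_eq.
have -> : \sum_(i < k) al i * t `^ a i = \sum_(i < k) al i * 0 `^ a i +
    \sum_(i < k) t `^ a i * (if a i == 0 then 0 else al i).
  rewrite -big_split /=; apply: eq_bigr => i _.
  have [->|ai] := eqVneq (a i) 0; first by rewrite !powRr0 mulr1 mulr0 addr0.
  by rewrite powR0// mulr0 add0r mulrC.
by ring.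
Qed.

Lemma Rot_uexpansion x : Rot x -> uexpansion (fun t _ => x t - x 0).
Proof.
move=> /Rot_expansion[k [b [a [a0 [_ H]]]]].
by exists 'I_k, a, (fun i _ => b i); split=> // i; exact: cont01_cst.
Qed.

Lemma upowerD (g h : R -> R -> R) : upower g -> upower h -> upower (fun t s => g t s + h t s : R).
Proof.
move=> [e [C [e0 gC]]] [e' [C' [e'0 hC]]].
exists (Num.min e e'), (`|C| + `|C'|); split; first by rewrite lt_min e0.
near=> t => s s01.
have t01 : 0 < t <= 1 by near: t; exact: near0_itv01.
rewrite mulrDl; apply: le_trans (ler_normD _ _) _; apply: lerD.
  apply: (@le_trans _ _ (C * t `^ e)).
    by move: s s01; near: t.
  rewrite (le_trans (ler_wpM2r (powR_ge0 _ _) (ler_norm C)))// ler_wpM2l//.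
  by rewrite ger_powR// ge_min lexx.
apply: (@le_trans _ _ (C' * t `^ e')).
  by move: s s01; near: t.
rewrite (le_trans (ler_wpM2r (powR_ge0 _ _) (ler_norm C')))// ler_wpM2l//.
by rewrite ger_powR// ge_min lexx orbT.
Unshelve. all: by end_near. Qed.

Lemma upowerMl (g h : R -> R -> R) : ubounded g -> upower h ->
  upower (fun t s => g t s * h t s : R).
Proof.
move=> [M gM] [e [C [e0 hC]]]; exists e, (M * C); split=> //.
apply: filterS2 gM hC => t gt ht s s01.
by rewrite normrM -mulrA ler_pM ?gt ?ht.
Qed.

Lemma upower_unifo (h : R -> R -> R) : unifo 1 h -> upower h.
Proof.
move=> /(_ 1 ltr01) H; exists 1, 1; split=> //.
Qed.

Lemma upower_ext (g h : R -> R -> R) : (forall t s, g t s = h t s) -> upower g -> upower h.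
Proof.
by move=> E; rewrite (_ : g = h)//; apply/funext => t; apply/funext => s.
Qed.

Lemma Rot_upower x : Rot x -> upower (fun t _ => x t - x 0).
Proof.
move=> /Rot_expansion[k [b [a [a0 [b0 H]]]]].
have S : upower (fun t _ => \sum_i t `^ a i * b i).
  elim: (index_enum _) => [|i r IH].
    exists 1, 0; split=> //; near=> t => s _.
    by rewrite big_nil normr0 mul0r.
  apply: (@upower_ext (fun t s => t `^ a i * b i + \sum_(i <- r) t `^ a i * b i)).
    by move=> t s; rewrite big_cons.
  apply: upowerD IH; have [ai|ai] := eqVneq (a i) 0.
    exists 1, 0; split=> //; near=> t => s _.
    by rewrite b0// mulr0 normr0 mul0r.
  exists (a i), `|b i|; split; first by rewrite lt_neqAle eq_sym ai a0.
  by near=> t => s _; rewrite normrM mulrC (ger0_norm (powR_ge0 _ _)).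
by apply: upower_ext (upowerD (upower_unifo H) S) => t s; rewrite subrK.
Unshelve. all: by end_near. Qed.

Lemma Rot_near x eps : Rot x -> 0 < eps -> \forall t \near 0^'+, `|x t - x 0| <= eps.
Proof.
move=> /Rot_upower H eps0; apply: filterS (upower_small H eps0) => t /(_ 0).
by apply; rewrite lexx ler01.
Qed.

Lemma quasi_ge0_std u : Rot u -> quasi_ge0 u -> 0 <= u 0.
Proof.
move=> Ru au; rewrite leNgt; apply/negP => u0.
have e0 : 0 < - u 0 / 4 by lra.
near (0:R)^'+ => t.
have : `|u t - u 0| <= - u 0 / 4 by near: t; exact: Rot_near.
have : - (- u 0 / 4 * t) <= u t by near: t; exact: au.
have /andP[t0 t1] : 0 < t <= 1 by near: t; exact: near0_itv01.
rewrite ler_norml => H1 /andP[_ H2].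
have : - u 0 / 4 * t <= - u 0 / 4 by rewrite ler_piMr// ltW.
lra.
Unshelve. all: by end_near. Qed.

Lemma std_quasi_ge0 u : Rot u -> 0 < u 0 -> quasi_ge0 u.
Proof.
move=> Ru u0; apply: quasi_ge0_near.
by apply: filterS (Rot_near Ru u0) => t; rewrite ler_norml; lra.
Qed.

Lemma rep_Rot X x : rep X x -> Rot x.
Proof. by case: X => A [y [Ry EA]]; rewrite /rep /= EA => -[]. Qed.

Lemma rep_fsim X x y : rep X x -> rep X y -> fsim x y.
Proof.
case: X => A [z [Rz EA]]; rewrite /rep /= EA => -[_ zx] [_ zy].
exact: fsim_trans (fsim_sym zx) zy.
Qed.

Lemma rep_of_fsim X x y : rep X x -> fsim x y -> rep X y.
Proof.
case: X => A [z [Rz EA]]; rewrite /rep /= EA => -[Rx zx] xy.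
by split; [exact: Rot_fsim xy|exact: fsim_trans xy].
Qed.

Lemma rep_ex X : exists x, rep X x.
Proof.
by case: X => A [y [Ry EA]]; exists y; rewrite /rep /= EA; split=> //; exact: fsim_refl.
Qed.

Lemma rep_of_Rot x : Rot x -> exists X, rep X x.
Proof.
move=> Rx; have H : exists y, Rot y /\ [set z | Rot z /\ fsim x z] = [set z | Rot z /\ fsim y z].
  by exists x.
by exists (exist (fun A : set (R -> R) => exists y,
  Rot y /\ A = [set z | Rot z /\ fsim y z]) _ H); split=> //; exact: fsim_refl.
Qed.

Lemma rep_inj X Y x : rep X x -> rep Y x -> X = Y.
Proof.
move=> Xx Yx; have E : proj1_sig X = proj1_sig Y.
  apply/seteqP; split=> y.
    by move=> /(rep_fsim Xx) /(rep_of_fsim Yx).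
  by move=> /(rep_fsim Yx) /(rep_of_fsim Xx).
case: X Y E {Xx Yx} => A HA [B HB] /= E; subst B.
by congr exist; exact: Prop_irrelevance.
Qed.

Lemma rep_max X x y : rep X x -> Rot y -> quasi_ge0 (fun t => x t - y t) ->
  rep X (fun t => Num.max (x t) (y t)).
Proof.
move=> Xx Ry H; apply: (rep_of_fsim Xx); apply/fsimP; split.
  have := quasi_ge0_std (RotB (rep_Rot Xx) Ry) H; rewrite subr_ge0 => yx.
  by rewrite max_l.
move=> eps eps0; apply: filterS2 (near0_itv01 R) (H _ eps0) => t /andP[t0 _] Ht.
have et : 0 < eps * t by rewrite mulr_gt0.
by rewrite ler_norml; case: (leP (x t) (y t)) => xy; lra.
Qed.

Lemma fleP X Y x y : rep X x -> rep Y y ->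
  fle X Y <-> quasi_ge0 (fun t => y t - x t).
Proof.
move=> Xx Yy; split.
  move=> [x' [y' [Xx' [Yy' [z [Rz [/fsimP[z0 zo] [d [d0 H]]]]]]]]].
  have /fsimP[_ xx'] := rep_fsim Xx' Xx.
  have /fsimP[_ yy'] := rep_fsim Yy Yy'.
  have H' : quasi_ge0 (fun t => y' t + z t - x' t).
    apply: quasi_ge0_near; near=> t.
    have t0 : 0 < t by near: t; exact: nbhs_right_gt.
    have td : t < d by near: t; exact: nbhs_right_lt.
    by rewrite subr_ge0; apply: H; rewrite ?ltW.
  by apply: quasi_ge0_negl H' _; apply: negl_ext (neglB (neglD xx' yy') zo) => t; ring.
move=> H; exists x, y; split=> //; split=> //.
pose m t := Num.max (y t) (x t).
have Ym : rep Y m by exact: rep_max (rep_Rot Xx) H.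
exists (fun t => m t - y t); split; first by apply: RotB; [exact: rep_Rot Ym|exact: rep_Rot Yy].
split.
  by have := rep_fsim Ym Yy; rewrite /fsim; congr littleo_t; apply/funext => t; rewrite subr0.
by exists 1; split=> // t _ _; rewrite subrKC le_max lexx orbT.
Unshelve. all: by end_near. Qed.

Lemma stdP X x r : rep X x -> std X r <-> r = x 0.
Proof.
move=> Xx; split=> [[y [Xy <-]]|->]; last by exists x.
by have /fsimP[] := rep_fsim Xy Xx.
Qed.

Lemma fle_trans X Y Z : fle X Y -> fle Y Z -> fle X Z.
Proof.
have [[[x Xx] [y Yy]] [z Zz]] := (rep_ex X, rep_ex Y, rep_ex Z).
rewrite (fleP Xx Yy) (fleP Yy Zz) (fleP Xx Zz) => H1 H2.
by apply: quasi_ge0_ext (quasi_ge0D H1 H2) => t; ring.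
Qed.

Lemma fle_std X Y x y : rep X x -> rep Y y -> fle X Y -> x 0 <= y 0.
Proof.
move=> Xx Yy; rewrite (fleP Xx Yy) => /(quasi_ge0_std (RotB (rep_Rot Yy) (rep_Rot Xx))).
by rewrite subr_ge0.
Qed.

Lemma std_fle X Y x y : rep X x -> rep Y y -> x 0 < y 0 -> fle X Y.
Proof.
move=> Xx Yy xy; rewrite (fleP Xx Yy).
by apply: std_quasi_ge0; rewrite ?subr_gt0//; apply: RotB; [exact: rep_Rot Yy|exact: rep_Rot Xx].
Qed.

Lemma fle_anti X Y : fle X Y -> fle Y X -> X = Y.
Proof.
have [[x Xx] [y Yy]] := (rep_ex X, rep_ex Y).
move=> XY YX; apply: (rep_inj Xx); apply: (rep_of_fsim Yy); apply/fsimP; split.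
  by apply/eqP; rewrite eq_le (fle_std Xx Yy XY) (fle_std Yy Xx YX).
move: XY YX; rewrite (fleP Xx Yy) (fleP Yy Xx) => XY YX eps eps0.
by apply: filterS2 (XY _ eps0) (YX _ eps0) => t H1 H2; rewrite ler_norml; lra.
Qed.

Lemma fle_refl X : fle X X.
Proof.
have [x Xx] := rep_ex X; apply/(fleP Xx Xx); apply: quasi_ge0_near.
by near=> t; rewrite subrr.
Unshelve. all: by end_near. Qed.

Lemma lower_end (a : eFR R) ra (L : set (FR R)) : estd a ra ->
  (L = [set X | efle a (Defs.EFin X)] \/ L = [set X | efle a (Defs.EFin X) /\ a <> Defs.EFin X]) ->
  (forall X Y, L X -> fle X Y -> L Y) /\
  (forall X x, rep X x -> (ra < (x 0)%:E)%E -> L X).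
Proof.
move=> ara HL.
have H1 X Y : efle a (Defs.EFin X) -> fle X Y -> efle a (Defs.EFin Y).
  by case: a ara HL => [A| |] //= _ _; exact: fle_trans.
have H2 X x : rep X x -> (ra < (x 0)%:E)%E -> efle a (Defs.EFin X) /\ a <> Defs.EFin X.
  case: a ara {HL H1} => [A [s [As ->]]|->|->] Xx //=; rewrite lte_fin.
  have [y Ay] := rep_ex A; move: As; rewrite (stdP _ Ay) => -> yx; split.
    exact: std_fle Ay Xx yx.
  move=> [] E; rewrite E in Ay; have := fle_std Xx Ay (fle_refl X).
  by rewrite leNgt yx.
case: HL => ->; split.
- exact: H1.
- by move=> X x Xx xr; have [] := H2 _ _ Xx xr.
- move=> X Y [aX nX] XY; split; first exact: H1 XY.
  by move=> aY; apply: nX; rewrite aY in aX *; congr Defs.EFin; exact: fle_anti.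
- exact: H2.
Qed.

Lemma upper_end (b : eFR R) rb (U : set (FR R)) : estd b rb ->
  (U = [set X | efle (Defs.EFin X) b] \/ U = [set X | efle (Defs.EFin X) b /\ Defs.EFin X <> b]) ->
  (forall X Y, U Y -> fle X Y -> U X) /\
  (forall X x, rep X x -> ((x 0)%:E < rb)%E -> U X).
Proof.
move=> brb HU.
have H1 X Y : efle (Defs.EFin Y) b -> fle X Y -> efle (Defs.EFin X) b.
  by case: b brb HU => [B| |] //= _ _ YB XY; exact: fle_trans YB.
have H2 X x : rep X x -> ((x 0)%:E < rb)%E -> efle (Defs.EFin X) b /\ Defs.EFin X <> b.
  case: b brb {HU H1} => [B [s [Bs ->]]|->|->] Xx //=; rewrite lte_fin.
  have [y By] := rep_ex B; move: Bs; rewrite (stdP _ By) => -> yx; split.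
    exact: std_fle Xx By yx.
  move=> [] E; rewrite -E in By; have := fle_std By Xx (fle_refl X).
  by rewrite leNgt yx.
case: HU => ->; split.
- exact: H1.
- by move=> X x Xx xr; have [] := H2 _ _ Xx xr.
- move=> X Y [Yb nY] XY; split; first exact: H1 Yb XY.
  by move=> Xb; apply: nY; rewrite -Xb in Yb *; congr Defs.EFin; exact: fle_anti.
- exact: H2.
Qed.

Lemma ninf_intervalP (J : set (FR R)) : ninf_interval J ->
  exists (L U : set (FR R)) (ra rb : \bar R), [/\ J = L `&` U, (ra < rb)%E,
    (forall X Y, L X -> fle X Y -> L Y) /\
    (forall X x, rep X x -> (ra < (x 0)%:E)%E -> L X) &
    (forall X Y, U Y -> fle X Y -> U X) /\
    (forall X x, rep X x -> ((x 0)%:E < rb)%E -> U X)].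
Proof.
move=> [a [b [_ [[ra [rb [ara [brb rab]]]] HJ]]]].
pose L0 := [set X | efle a (Defs.EFin X)]; pose L1 := [set X | efle a (Defs.EFin X) /\ a <> Defs.EFin X].
pose U0 := [set X | efle (Defs.EFin X) b]; pose U1 := [set X | efle (Defs.EFin X) b /\ Defs.EFin X <> b].
have E0 := lower_end ara (or_introl (erefl L0)).
have E1 := lower_end ara (or_intror (erefl L1)).
have F0 := upper_end brb (or_introl (erefl U0)).
have F1 := upper_end brb (or_intror (erefl U1)).
case: HJ => [|[|[|]]] ->.
- by exists L0, U0, ra, rb.
- by exists L1, U1, ra, rb.
- by exists L0, U1, ra, rb.
- by exists L1, U0, ra, rb.
Qed.

Lemma ninf_interval_convex (J : set (FR R)) X Y Z :
  ninf_interval J -> J X -> J Y -> fle X Z -> fle Z Y -> J Z.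
Proof.
move=> /ninf_intervalP[L [U [ra [rb [-> _ [L1 _] [U1 _]]]]]] [LX UX] [LY UY] XZ ZY.
by split; [exact: L1 XZ|exact: U1 ZY].
Qed.

Lemma ninf_interval_thick (J : set (FR R)) X x (d : R) :
  ninf_interval J -> J X -> rep X x -> 0 < d ->
  exists eps, [/\ eps != 0, `|eps| <= d &
    forall s, 0 <= s <= 1 -> forall Z, rep Z (fun t => x t + s * eps) -> J Z].
Proof.
move=> /ninf_intervalP[L [U [ra [rb [-> rab [L1 L2] [U1 U2]]]]]] [LX UX] Xx d0.
have [xb|bx] := ltP (x 0)%:E rb.
  have [e e0 eb] : exists2 e, 0 < e & ((x 0 + e)%:E < rb)%E.
    case: rb xb {rab U2} => [r| |]; rewrite ?ltNge ?leNye//.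
    - rewrite -ltNge lte_fin => xr; exists ((r - x 0) / 2); rewrite ?lte_fin; lra.
    - by move=> _; exists 1 => //; rewrite ltNge leye_eq.
  exists (Num.min d e); rewrite ger0_norm ?le_min ?(ltW d0) ?(ltW e0)//; split=> //.
  - by rewrite gt_eqF// lt_min d0.
  - by rewrite ge_min lexx.
  move=> s /andP[s0 s1] Z Zz.
  have m0 : 0 <= Num.min d e by rewrite le_min !ltW.
  have se : 0 <= s * Num.min d e by rewrite mulr_ge0.
  split.
    apply: (L1 X) => //; apply/(fleP Xx Zz); apply: quasi_ge0_near.
    by near=> t; rewrite addrAC subrr add0r.
  apply: (U2 Z _ Zz); apply: le_lt_trans eb; rewrite lee_fin lerD2l.
  by rewrite (le_trans (ler_piMl m0 s1))// ge_min lexx orbT.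
have ax : (ra < (x 0)%:E)%E by exact: lt_le_trans rab bx.
have [e e0 eb] : exists2 e, 0 < e & (ra < (x 0 - e)%:E)%E.
  case: ra ax {rab L2} => [r| |].
  - rewrite lte_fin => xr; exists ((x 0 - r) / 2); rewrite ?lte_fin; lra.
  - by rewrite ltNge leey.
  - by move=> _; exists 1 => //; rewrite ltNyr.
exists (- Num.min d e); rewrite normrN oppr_eq0.
rewrite ger0_norm ?le_min ?(ltW d0) ?(ltW e0)//; split=> //.
- by rewrite gt_eqF// lt_min d0.
- by rewrite ge_min lexx.
move=> s /andP[s0 s1] Z Zz.
have m0 : 0 <= Num.min d e by rewrite le_min !ltW.
have se : 0 <= s * Num.min d e by rewrite mulr_ge0.
split.
  apply: (L2 Z _ Zz); apply: lt_le_trans eb _; rewrite lee_fin lerD2l mulrN lerN2.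
  by rewrite (le_trans (ler_piMl m0 s1))// ge_min lexx orbT.
apply: (U1 _ X) => //; apply/(fleP Zz Xx); apply: quasi_ge0_near.
by near=> t; rewrite opprD addrA subrr add0r mulrN opprK.
Unshelve. all: by end_near. Qed.

End FermatReals.

(** * Local representations of smooth functions *)

Section LocalRepresentations.
Variable R : realType.
Implicit Types (X Y Z : FR R).

Definition pvec q (v : 'rV[R]_q) (s : R) : 'rV[R]_(q + 1) := row_mx v (const_mx s).

Definition uncur q (alpha : 'rV[R]_q -> R -> R) (z : 'rV[R]_(q + 1)) :=
  alpha (lsubmx z) (rsubmx z 0 0).

Definition prodset q (P : set 'rV[R]_q) (V : set R) :=
  [set z : 'rV[R]_(q + 1) | P (lsubmx z) /\ V (rsubmx z 0 0)].

Lemma uncur_pvec q alpha (v : 'rV[R]_q) s : uncur alpha (pvec v s) = alpha v s.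
Proof. by rewrite /uncur row_mxKl row_mxKr mxE. Qed.

Lemma pvec_last q (v : 'rV[R]_q) (s x : R) :
  pvec v s + x *: delta_mx 0 (rshift q ord0) = pvec v (s + x).
Proof.
apply/rowP => j; rewrite mxE; case: (split_ordP j) => i ->.
  by rewrite !row_mxEl !mxE eq_lrshift andbF mulr0 addr0.
by rewrite !row_mxEr !mxE (ord1 i) !eqxx mulr1.
Qed.

Lemma derive1_uncur q alpha :
  uncur (fun (v : 'rV[R]_q) s => derive1 (alpha v) s) =
  (fun z => 'D_(delta_mx 0 (rshift q ord0)) (uncur alpha) z).
Proof.
apply/funext => z.
have E : z = pvec (lsubmx z) (rsubmx z 0 0).
  rewrite /pvec -[LHS]hsubmxK; congr row_mx.
  by apply/rowP => j; rewrite !mxE (ord1 j).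
have F : (fun h : R => h^-1 *: (alpha (lsubmx z) (h + rsubmx z 0 0) -
      alpha (lsubmx z) (rsubmx z 0 0))) =
    (fun h : R => h^-1 *: ((uncur alpha \o shift z) (h *: delta_mx 0 (rshift q ord0)) -
      uncur alpha z)).
  apply/funext => h; congr (_ *: (_ - _)).
  have /= -> : (uncur alpha \o shift z) (h *: delta_mx 0 (rshift q ord0)) =
     uncur alpha (pvec (lsubmx z) (rsubmx z 0 0 + h)).
    by rewrite -pvec_last -E /= addrC.
  by rewrite uncur_pvec addrC.
by rewrite {1}/uncur /derive1 /derive F.
Qed.

Lemma smooth_derive1 q P V (alpha : 'rV[R]_q -> R -> R) :
  smooth_on_prod P V alpha -> smooth_on_prod P V (fun v s => derive1 (alpha v) s).
Proof.
move=> sa; change (Cinf (prodset P V) (uncur (fun v s => derive1 (alpha v) s))).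
rewrite derive1_uncur; exact: CinfD.
Qed.

Lemma smooth_is_derive q P V (alpha : 'rV[R]_q -> R -> R) v s :
  smooth_on_prod P V alpha -> P v -> V s ->
  is_derive s 1 (alpha v) (derive1 (alpha v) s).
Proof.
move=> sa Pv Vs.
have Uz : prodset P V (pvec v s) by split; rewrite ?row_mxKl ?row_mxKr ?mxE.
have := @line_derive R (q + 1) (uncur alpha) (pvec v 0) (delta_mx 0 (rshift q ord0)) s.
rewrite pvec_last add0r => /(_ (Cinf_derivable sa Uz)).
have -> : (fun x : R => uncur alpha (pvec v 0 + x *: delta_mx 0 (rshift q ord0))) = alpha v.
  by apply/funext => x; rewrite pvec_last add0r uncur_pvec.
move=> H; have -> // : derive1 (alpha v) s =
  'D_(delta_mx 0 (rshift q ord0)) (uncur alpha) (pvec v s).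
by rewrite derive1E; exact: derive_val.
Qed.

Lemma box_pvec q (v v' : 'rV[R]_q) s s' r :
  box (pvec v s) r (pvec v' s') <-> box v r v' /\ `|s' - s| <= r.
Proof.
split=> [H|[H1 H2] j].
  split=> [i|]; first by have := H (lshift 1 i); rewrite !row_mxEl.
  by have := H (rshift q ord0); rewrite !row_mxEr !mxE.
by case: (split_ordP j) => i ->; rewrite ?row_mxEl ?row_mxEr ?mxE.
Qed.

Lemma open_box q (P : set 'rV[R]_q) (V : set R) v s : open P -> open V -> P v -> V s ->
  exists2 r, 0 < r & box (pvec v s) r `<=` prodset P V.
Proof.
move=> oP oV Pv Vs.
have /nbhs_ballP[e1 /= e10 H1] := open_nbhs_nbhs (conj oP Pv).
have /nbhs_ballP[e2 /= e20 H2] := open_nbhs_nbhs (conj oV Vs).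
have r0 : 0 < Num.min e1 e2 / 2 by rewrite divr_gt0// lt_min e10.
have re1 : Num.min e1 e2 / 2 < e1.
  by have : Num.min e1 e2 <= e1 by [rewrite ge_min lexx]; lra.
have re2 : Num.min e1 e2 / 2 < e2.
  by have : Num.min e1 e2 <= e2 by [rewrite ge_min lexx orbT]; lra.
exists (Num.min e1 e2 / 2) => // z bz; split.
  apply: H1; rewrite mx_norm_ball /ball_ /= [X in X < _]/Num.norm /= mx_normrE.
  apply/bigmax_ltP; split=> // -[a b] _ /=; rewrite !mxE !ord1 distrC.
  by apply: le_lt_trans re1; have := bz (lshift 1 b); rewrite row_mxEl.
apply: H2; rewrite /ball /= distrC; apply: le_lt_trans re2.
by have := bz (rshift q ord0); rewrite row_mxEr !mxE.
Qed.

Definition rowf q (pr : 'I_q -> R -> R) (t : R) : 'rV[R]_q := \row_i pr i t.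

Lemma rowf_near q (pr : 'I_q -> R -> R) r : (forall i, Rot (pr i)) -> 0 < r ->
  \forall t \near 0^'+, box (rowf pr 0) r (rowf pr t).
Proof.
move=> Rp r0; have : \forall t \near 0^'+, forall i, `|pr i t - pr i 0| <= r.
  by apply: filter_forall => i; exact: Rot_near.
by apply: filterS => t Ht i; rewrite !mxE.
Qed.

Lemma alpha_indep q P V (alpha : 'rV[R]_q -> R -> R) pr pr' y y' :
  open P -> open V -> smooth_on_prod P V alpha ->
  (forall i, Rot (pr i)) -> Rot y ->
  (forall i, fsim (pr' i) (pr i)) -> fsim y' y ->
  P (rowf pr 0) -> V (y 0) ->
  negl (fun t => alpha (rowf pr' t) (y' t) - alpha (rowf pr t) (y t)).
Proof.
move=> oP oV sa Rp Ry pp' yy' Pv Vs.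
have [r r0 bU] := open_box oP oV Pv Vs.
have [M HM] := Cinf_lipschitz r0 sa bU.
have r20 : 0 < r / 2 by rewrite divr_gt0.
pose d i t := pvec (rowf pr' t) (y' t) 0 i - pvec (rowf pr t) (y t) 0 i.
have da i : negl (d i).
  rewrite /d; case: (split_ordP i) => j ->.
    have /fsimP[_] := pp' j; apply: negl_ext => t.
    by rewrite !row_mxEl !mxE.
  by have /fsimP[_] := yy'; apply: negl_ext => t; rewrite !row_mxEr !mxE.
have S : negl (fun t => \sum_i M i * `|d i t|).
  elim: (index_enum _) => [|i s IH].
    by move=> eps eps0; apply: filterS (near0_itv01 R) => t /andP[t0 _];
      rewrite big_nil normr0 mulr_ge0 ?ltW.
  apply: (@negl_ext R (fun t => M i * `|d i t| + \sum_(i <- s) M i * `|d i t|)).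
    by move=> t; rewrite big_cons.
  apply: neglD IH; apply: neglZ => eps eps0.
  by apply: filterS (da i eps eps0) => t; rewrite normr_id.
move=> eps eps0; near=> t.
have dt : forall i, `|d i t| <= r / 2.
  near: t; apply: filter_forall => i; have := da i _ r20.
  apply: filterS2 (near0_itv01 R) => t /andP[t0 t1] Ht; apply: le_trans Ht _.
  by rewrite ler_piMr// ltW.
have bt : box (pvec (rowf pr 0) (y 0)) (r / 2) (pvec (rowf pr t) (y t)).
  by apply/box_pvec; split; near: t; [exact: rowf_near|exact: Rot_near].
have St : `|\sum_i M i * `|d i t| | <= eps * t by near: t; exact: S.
apply: le_trans St; apply: le_trans (ler_norm _).
by rewrite -(uncur_pvec alpha (rowf pr' t)) -(uncur_pvec alpha (rowf pr t)); exact: HM.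
Unshelve. all: by end_near. Qed.

Lemma fext_negl q P V (alpha : 'rV[R]_q -> R -> R) p pr Y y Z z :
  open P -> open V -> smooth_on_prod P V alpha ->
  (forall i, rep (p i) (pr i)) -> rep Y y -> P (rowf pr 0) -> V (y 0) ->
  fext alpha p Y Z -> rep Z z ->
  negl (fun t => z t - alpha (rowf pr t) (y t)).
Proof.
move=> oP oV sa pp Yy Pv Vs [pr' [y' [pp' [Yy' Zz']]]] Zz.
have /fsimP[_ H1] := rep_fsim Zz Zz'.
have H2 := alpha_indep oP oV sa (fun i => rep_Rot (pp i)) (rep_Rot Yy)
  (fun i => rep_fsim (pp' i) (pp i)) (rep_fsim Yy' Yy) Pv Vs.
by apply: negl_ext (neglD H1 H2) => t; rewrite addrA subrK.
Qed.

Lemma uexpansion_alpha q P V (alpha : 'rV[R]_q -> R -> R) pr x h c r :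
  0 < r -> smooth_on_prod P V alpha -> box (pvec (rowf pr 0) c) r `<=` prodset P V ->
  (forall i, Rot (pr i)) -> Rot x -> Rot h ->
  (forall s, 0 <= s <= 1 -> `|x 0 + s * h 0 - c| <= r / 2) ->
  uexpansion (fun t s => alpha (rowf pr t) (x t + s * h t)).
Proof.
move=> r0 sa bU Rp Rx Rh inr.
pose z0 s := pvec (rowf pr 0) (x 0 + s * h 0).
pose w t s := pvec (rowf pr t - rowf pr 0) ((x t - x 0) + s * (h t - h 0)).
have Eh (t s : R) : (x t - x 0) + s * (h t - h 0) = w t s 0 (rshift q ord0).
  by rewrite row_mxEr mxE.
have Ep (t s : R) j : pr j t - pr j 0 = w t s 0 (lshift 1 j).
  by rewrite row_mxEl !mxE.
apply: (@uexpansion_ext R (fun t s => uncur alpha (z0 s + w t s))).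
  move=> t s; rewrite -(uncur_pvec alpha); congr uncur; rewrite /z0 /w /pvec add_row_mx.
  congr row_mx; first by rewrite addrC subrK.
  by apply/rowP => j; rewrite !mxE; ring.
apply: (@uexpansion_comp R _ (prodset P V) _ (pvec (rowf pr 0) c) r) => //.
- move=> i; case: (split_ordP i) => j ->.
    rewrite (_ : (fun s => _) = fun=> pr j 0); first exact: cont01_cst.
    by apply/funext => s; rewrite row_mxEl mxE.
  rewrite (_ : (fun s => _) = fun s => x 0 + s * h 0).
    move=> s _; apply: continuousD; first exact: cst_continuous.
    by apply: continuousM; [exact: cvg_id|exact: cst_continuous].
  by apply/funext => s; rewrite row_mxEr mxE.
- move=> s s01; apply/box_pvec; split; last exact: inr.
  by move=> i; rewrite subrr normr0 divr_ge0// ltW.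
- move=> i; case: (split_ordP i) => j ->.
    by apply: uexpansion_ext (Rot_uexpansion (Rp j)) => t s; exact: Ep.
  rewrite (ord1 j); apply: uexpansion_ext Eh _.
  apply: uexpansionD (Rot_uexpansion Rx) (uexpansionM _ (Rot_uexpansion Rh)).
  exact: uexpansion_coef (@cont01_id R).
- move=> i; case: (split_ordP i) => j ->.
    by apply: upower_ext (Rot_upower (Rp j)) => t s; exact: Ep.
  rewrite (ord1 j); apply: upower_ext Eh _.
  apply: upowerD (Rot_upower Rx) (upowerMl _ (Rot_upower Rh)).
  exact: uexpansion_bnd (uexpansion_coef (@cont01_id R)).
Qed.

Lemma is_derive_alpha q P V (alpha : 'rV[R]_q -> R -> R) pr x h c r :
  0 < r -> smooth_on_prod P V alpha -> box (pvec (rowf pr 0) c) r `<=` prodset P V ->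
  (forall i, Rot (pr i)) -> Rot x -> Rot h ->
  (forall s, 0 <= s <= 1 -> `|x 0 + s * h 0 - c| <= r / 2) ->
  \forall t \near 0^'+, forall s : R, 0 <= s <= 1 ->
    is_derive s 1 (fun s : R => alpha (rowf pr t) (x t + s * h t))
      (h t * derive1 (alpha (rowf pr t)) (x t + s * h t)).
Proof.
move=> r0 sa bU Rp Rx Rh inr; have r4 : 0 < r / 4 by rewrite divr_gt0.
near=> t => s s01.
have bt : box (rowf pr 0) r (rowf pr t) by near: t; exact: rowf_near.
have xt : `|x t - x 0| <= r / 4 by near: t; exact: Rot_near.
have ht : `|h t - h 0| <= r / 4 by near: t; exact: Rot_near.
have [|Pt Vt] := bU (pvec (rowf pr t) (x t + s * h t)).
  apply/box_pvec; split=> //; have /andP[s0 s1] := s01.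
  have sh : `|s * (h t - h 0)| <= r / 4.
    by rewrite normrM (ger0_norm s0) (le_trans _ ht)// ler_piMl.
  have -> : x t + s * h t - c = (x 0 + s * h 0 - c) + (x t - x 0) + s * (h t - h 0) by ring.
  by move: (inr s s01) xt sh; rewrite !ler_norml; lra.
rewrite row_mxKl in Pt; rewrite row_mxKr mxE in Vt.
rewrite mulrC; apply: (@is_derive1_comp R (alpha (rowf pr t)) (fun s => x t + s * h t)).
  exact: smooth_is_derive sa Pt Vt.
have -> : (fun s => x t + s * h t) = cst (x t) + (h t \*: id).
  by apply/funext => u; rewrite /= /GRing.scale /= mulrC.
by apply: is_derive_eq; rewrite add0r /GRing.scale /= mulr1.
Unshelve. all: by end_near. Qed.

Lemma local_rep_reps S I X V q P p alpha x : @local_rep R S I X V q P p alpha -> rep X x ->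
  [/\ open V, V (x 0), open P, smooth_on_prod P V alpha &
    exists pr, (forall i, rep (p i) (pr i)) /\ P (rowf pr 0)].
Proof.
move=> [oV [[r [Xr Vr]] [oP [[v [pv Pv]] [sa _]]]]] Xx; split=> //.
  by move: Xr; rewrite (stdP _ Xx) => <-.
have [pr Hpr] := choice (fun i => rep_ex (p i)).
exists pr; split=> //; rewrite (_ : rowf pr 0 = v)//.
by apply/rowP => i; rewrite mxE; have := pv i; rewrite (stdP _ (Hpr i)).
Qed.

Lemma local_rep_negl S I X V q P p alpha (pr : 'I_q -> R -> R) Y y u :
  @local_rep R S I X V q P p alpha -> (forall i, rep (p i) (pr i)) -> P (rowf pr 0) ->
  S Y -> rep Y y -> V (y 0) -> rep (I Y) u ->
  negl (fun t => u t - alpha (rowf pr t) (y t)).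
Proof.
move=> [oV [_ [oP [_ [sa H]]]]] pp Pv SY Yy Vy.
apply: (fext_negl oP oV sa pp Yy Pv Vy); apply: H SY; exists (y 0); split=> //.
exact/(stdP _ Yy).
Qed.

Lemma local_rep_move S I X V q P p alpha Y y :
  @local_rep R S I X V q P p alpha -> rep Y y -> V (y 0) -> local_rep S I Y V P p alpha.
Proof.
move=> [oV [_ H]] Yy Vy; split=> //; split=> //.
by exists (y 0); split=> //; exact/(stdP _ Yy).
Qed.

(* As [J] is not infinitesimal, both representations are valid at [x + s eps] for
   a real [eps <> 0] and all [s] in [0, 1]. *)
Lemma derivative_indep (J : set (FR R)) I X x V q P p alpha pr V' q' P' p' alpha' pr' :
  ninf_interval J -> J X -> rep X x ->
  @local_rep R J I X V q P p alpha -> (forall i, rep (p i) (pr i)) -> P (rowf pr 0) ->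
  @local_rep R J I X V' q' P' p' alpha' -> (forall i, rep (p' i) (pr' i)) -> P' (rowf pr' 0) ->
  negl (fun t => derive1 (alpha (rowf pr t)) (x t) - derive1 (alpha' (rowf pr' t)) (x t)).
Proof.
move=> HJ JX Xx L pp Pv L' pp' Pv'.
have [oV Vx oP sa _] := local_rep_reps L Xx.
have [oV' Vx' oP' sa' _] := local_rep_reps L' Xx.
have [r r0 bU] := open_box oP oV Pv Vx.
have [r' r'0 bU'] := open_box oP' oV' Pv' Vx'.
have d0 : 0 < Num.min r r' / 2 by rewrite divr_gt0// lt_min r0.
have [eps [eps0 epsd Heps]] := ninf_interval_thick HJ JX Xx d0.
have se s : 0 <= s <= 1 -> `|x 0 + s * eps - x 0| <= Num.min r r' / 2.
  move=> /andP[s0 s1]; rewrite addrAC subrr add0r normrM (ger0_norm s0).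
  by rewrite (le_trans _ epsd)// ler_piMl.
have ser s : 0 <= s <= 1 -> `|x 0 + s * eps - x 0| <= r / 2.
  move=> /se H; apply: le_trans H _.
  by have : Num.min r r' <= r by [rewrite ge_min lexx]; lra.
have ser' s : 0 <= s <= 1 -> `|x 0 + s * eps - x 0| <= r' / 2.
  move=> /se H; apply: le_trans H _.
  by have : Num.min r r' <= r' by [rewrite ge_min lexx orbT]; lra.
have Rx := rep_Rot Xx; have Re := Rot_cst eps.
have Rp i := rep_Rot (pp i); have Rp' i := rep_Rot (pp' i).
have U := uexpansion_alpha r0 (smooth_derive1 sa) bU Rp Rx Re ser.
have U' := uexpansion_alpha r'0 (smooth_derive1 sa') bU' Rp' Rx Re ser'.
have D := is_derive_alpha r0 sa bU Rp Rx Re ser.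
have D' := is_derive_alpha r'0 sa' bU' Rp' Rx Re ser'.
have := @derivative_negl R
  (fun t s => alpha (rowf pr t) (x t + s * eps) - alpha' (rowf pr' t) (x t + s * eps))
  _ (uexpansionM (uexpansion_cst eps) (uexpansionB U U')).
move=> /(_ _ _ 0) H.
have : negl (fun t => eps * (derive1 (alpha (rowf pr t)) (x t + 0 * eps) -
     derive1 (alpha' (rowf pr' t)) (x t + 0 * eps))).
  apply: H; last by rewrite lexx ler01.
    apply: filterS2 D D' => t Dt D't s s01.
    rewrite mulrBr; exact: is_deriveB (Dt s s01) (D't s s01).
  move=> s s01.
  have [Z Zz] := rep_of_Rot (RotD Rx (Rot_cst (s * eps))).
  have JZ := Heps s s01 Z Zz.
  have Vz : V (x 0 + s * eps).
    have [|_] := bU (pvec (rowf pr 0) (x 0 + s * eps)); last by rewrite row_mxKr mxE.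
    apply/box_pvec; split=> [i|]; first by rewrite subrr normr0 ltW.
    by apply: le_trans (ser s s01) _; lra.
  have Vz' : V' (x 0 + s * eps).
    have [|_] := bU' (pvec (rowf pr' 0) (x 0 + s * eps)); last by rewrite row_mxKr mxE.
    apply/box_pvec; split=> [i|]; first by rewrite subrr normr0 ltW.
    by apply: le_trans (ser' s s01) _; lra.
  have [u Iu] := rep_ex (I Z).
  have H1 := local_rep_negl L pp Pv JZ Zz Vz Iu.
  have H2 := local_rep_negl L' pp' Pv' JZ Zz Vz' Iu.
  by apply: negl_ext (neglB H2 H1) => t; ring.
move=> /(neglZ eps^-1); apply: negl_ext => t.
by rewrite mulrA mulVf// mul1r mul0r addr0.
Qed.

Lemma fderiv_negl (J : set (FR R)) I X x D d V q P p alpha pr :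
  ninf_interval J -> J X -> rep X x ->
  @local_rep R J I X V q P p alpha -> (forall i, rep (p i) (pr i)) -> P (rowf pr 0) ->
  fderiv J I X D -> rep D d ->
  negl (fun t => d t - derive1 (alpha (rowf pr t)) (x t)).
Proof.
move=> HJ JX Xx L pp Pv [V' [q' [P' [p' [alpha' [L' F]]]]]] Dd.
have [oV' Vx' oP' sa' [pr' [pp' Pv']]] := local_rep_reps L' Xx.
have H1 := fext_negl oP' oV' (smooth_derive1 sa') pp' Xx Pv' Vx' F Dd.
have H2 := derivative_indep HJ JX Xx L' pp' Pv' L pp Pv.
by apply: negl_ext (neglD H1 H2) => t; rewrite addrA subrK.
Qed.

Lemma monotone_local (J : set (FR R)) (f g If Ig : FR R -> FR R) a b X0 x0 :
  ninf_interval J ->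
  (forall X, fle a X -> fle X b -> fle (g X) (f X)) ->
  fsmooth J If -> fsmooth J Ig ->
  (forall X, J X -> fderiv J If X (f X)) -> (forall X, J X -> fderiv J Ig X (g X)) ->
  J X0 -> rep X0 x0 ->
  exists2 d, 0 < d & forall X Y x y u u' v v',
    J X -> J Y -> fle a X -> fle X Y -> fle Y b -> rep X x -> rep Y y ->
    `|x 0 - x0 0| <= d -> `|y 0 - x0 0| <= d ->
    rep (If X) u -> rep (If Y) u' -> rep (Ig X) v -> rep (Ig Y) v' ->
    quasi_ge0 (fun t => (u' t - v' t) - (u t - v t)).
Proof.
move=> HJ gf sIf sIg dIf dIg JX0 Xx0.
have [V [q [P [p [alpha L]]]]] := sIf _ JX0.
have [V' [q' [P' [p' [beta L']]]]] := sIg _ JX0.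
have [oV Vx oP sa [pr [pp Pv]]] := local_rep_reps L Xx0.
have [oV' Vx' oP' sa' [pr' [pp' Pv']]] := local_rep_reps L' Xx0.
have [r r0 bU] := open_box oP oV Pv Vx.
have [r' r'0 bU'] := open_box oP' oV' Pv' Vx'.
have d0 : 0 < Num.min r r' / 2 by rewrite divr_gt0// lt_min r0.
exists (Num.min r r' / 2) => // X Y x y u u' v v' JX JY aX XY Yb Xx Yy xd yd Iu Iu' Iv Iv'.
have {}XY' := XY; rewrite (fleP Xx Yy) in XY'.
pose m t := Num.max (y t) (x t).
have Ym : rep Y m := rep_max Yy (rep_Rot Xx) XY'.
have md : `|m 0 - x0 0| <= Num.min r r' / 2.
  by have /fsimP[<- _] := rep_fsim Yy Ym.
pose h t := m t - x t.
have h0 t : 0 <= h t by rewrite subr_ge0 le_max lexx orbT.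
have Rx := rep_Rot Xx; have Rh : Rot h := RotB (rep_Rot Ym) Rx.
have Rp i := rep_Rot (pp i); have Rp' i := rep_Rot (pp' i).
have inr s : 0 <= s <= 1 -> `|x 0 + s * h 0 - x0 0| <= Num.min r r' / 2.
  move=> /andP[s0 s1].
  have -> : x 0 + s * h 0 - x0 0 = (1 - s) * (x 0 - x0 0) + s * (m 0 - x0 0).
    by rewrite /h; ring.
  apply: le_trans (ler_normD _ _) _; rewrite !normrM (ger0_norm s0) ger0_norm ?subr_ge0//.
  have H1 := ler_wpM2l s0 md.
  have : (1 - s) * `|x 0 - x0 0| <= (1 - s) * (Num.min r r' / 2) by rewrite ler_wpM2l ?subr_ge0.
  lra.
have ser s : 0 <= s <= 1 -> `|x 0 + s * h 0 - x0 0| <= r / 2.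
  move=> /inr H; apply: le_trans H _.
  by have : Num.min r r' <= r by [rewrite ge_min lexx]; lra.
have ser' s : 0 <= s <= 1 -> `|x 0 + s * h 0 - x0 0| <= r' / 2.
  move=> /inr H; apply: le_trans H _.
  by have : Num.min r r' <= r' by [rewrite ge_min lexx orbT]; lra.
have inV s : 0 <= s <= 1 -> V (x 0 + s * h 0).
  move=> s01; have [|_] := bU (pvec (rowf pr 0) (x 0 + s * h 0)); last by rewrite row_mxKr mxE.
  apply/box_pvec; split=> [i|]; first by rewrite subrr normr0 ltW.
  by apply: le_trans (ser s s01) _; lra.
have inV' s : 0 <= s <= 1 -> V' (x 0 + s * h 0).
  move=> s01; have [|_] := bU' (pvec (rowf pr' 0) (x 0 + s * h 0)); last by rewrite row_mxKr mxE.
  apply/box_pvec; split=> [i|]; first by rewrite subrr normr0 ltW.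
  by apply: le_trans (ser' s s01) _; lra.
have U := uexpansion_alpha r0 (smooth_derive1 sa) bU Rp Rx Rh ser.
have U' := uexpansion_alpha r'0 (smooth_derive1 sa') bU' Rp' Rx Rh ser'.
have D := is_derive_alpha r0 sa bU Rp Rx Rh ser.
have D' := is_derive_alpha r'0 sa' bU' Rp' Rx Rh ser'.
have K := @increment_quasi_ge0 R
  (fun t s => alpha (rowf pr t) (x t + s * h t) - beta (rowf pr' t) (x t + s * h t))
  _ h (h 0 + 1) (uexpansionB U U').
have {K}K : quasi_ge0 (fun t =>
   (alpha (rowf pr t) (x t + 1 * h t) - beta (rowf pr' t) (x t + 1 * h t)) -
   (alpha (rowf pr t) (x t + 0 * h t) - beta (rowf pr' t) (x t + 0 * h t))).
  apply: K.
  - apply: filterS (Rot_near Rh ltr01) => t; rewrite h0 ler_norml /= => /andP[_]; lra.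
  - apply: filterS2 D D' => t Dt D't s s01.
    rewrite mulrBr; exact: is_deriveB (Dt s s01) (D't s s01).
  move=> s s01; have /andP[s0 s1] := s01.
  have [Z Zz] := rep_of_Rot (RotD Rx (RotZ s Rh)).
  have XZ : fle X Z.
    apply/(fleP Xx Zz); apply: quasi_ge0_near; near=> t.
    rewrite addrAC subrr add0r; exact: mulr_ge0.
  have ZY : fle Z Y.
    apply/(fleP Zz Ym); apply: quasi_ge0_near; near=> t.
    have -> : m t - (x t + s * h t) = (1 - s) * h t by rewrite /h; ring.
    by apply: mulr_ge0 => //; rewrite subr_ge0.
  have JZ := ninf_interval_convex HJ JX JY XZ ZY.
  have [w fw] := rep_ex (f Z); have [w' gw] := rep_ex (g Z).
  have := gf Z (fle_trans aX XZ) (fle_trans ZY Yb); rewrite (fleP gw fw) => ww'.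
  have H1 := fderiv_negl HJ JZ Zz (local_rep_move L Zz (inV s s01)) pp Pv (dIf Z JZ) fw.
  have H2 := fderiv_negl HJ JZ Zz (local_rep_move L' Zz (inV' s s01)) pp' Pv' (dIg Z JZ) gw.
  by apply: quasi_ge0_negl ww' _; apply: negl_ext (neglB H2 H1) => t; ring.
have [i0 i1] : (0 <= (0:R) <= 1) /\ (0 <= (1:R) <= 1) by rewrite !lexx ler01.
have V0 := inV 0 i0; rewrite mul0r addr0 in V0.
have V0' := inV' 0 i0; rewrite mul0r addr0 in V0'.
have V1 := inV 1 i1; rewrite mul1r subrKC in V1.
have V1' := inV' 1 i1; rewrite mul1r subrKC in V1'.
have A1 := local_rep_negl L pp Pv JX Xx V0 Iu.
have A2 := local_rep_negl L pp Pv JY Ym V1 Iu'.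
have B1 := local_rep_negl L' pp' Pv' JX Xx V0' Iv.
have B2 := local_rep_negl L' pp' Pv' JY Ym V1' Iv'.
apply: quasi_ge0_negl K _; apply: negl_ext (neglB (neglB A2 B2) (neglB A1 B1)) => t.
by rewrite !mul1r !mul0r !addr0 !subrKC; ring.
Unshelve. all: by end_near. Qed.

End LocalRepresentations.

Lemma fle_intermediate (R : realType) (a b : FR R) (xa xb : R -> R) (r : R) :
  fle a b -> rep a xa -> rep b xb -> xa 0 <= r <= xb 0 ->
  exists X x, [/\ rep X x, x 0 = r, fle a X & fle X b].
Proof.
move=> ab aa bb /andP[ar rb]; have ab' := ab; rewrite (fleP aa bb) in ab'.
pose m t := Num.max (xb t) (xa t).
have bm : rep b m := rep_max bb (rep_Rot aa) ab'.
have /fsimP[m0 _] := rep_fsim bb bm.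
have h0 t : 0 <= m t - xa t by rewrite subr_ge0 le_max lexx orbT.
(* when [xa 0 = xb 0] the junk value [0^-1 = 0] gives [th = 0], as wanted *)
pose th := (r - xa 0) / (xb 0 - xa 0).
have th0 : 0 <= th by rewrite divr_ge0// subr_ge0// (le_trans ar).
have th1 : 0 <= 1 - th.
  rewrite subr_ge0 /th; have [->|ne] := eqVneq (xb 0 - xa 0) 0; first by rewrite invr0 mulr0 ler01.
  by rewrite ler_pdivrMr ?mul1r ?lerD2r// lt_neqAle eq_sym ne subr_ge0 (le_trans ar).
have Rm := RotB (rep_Rot bm) (rep_Rot aa).
have [X Xx] := rep_of_Rot (RotD (rep_Rot aa) (RotZ th Rm)).
exists X, (fun t => xa t + th * (m t - xa t)); split=> //.
- rewrite -m0 /th; have [E|ne] := eqVneq (xb 0 - xa 0) 0.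
    by rewrite E mulr0 addr0; lra.
  by rewrite divfK// subrKC.
- apply/(fleP aa Xx); apply: quasi_ge0_near; near=> t.
  by rewrite addrAC subrr add0r; exact: mulr_ge0.
- apply/(fleP Xx bm); apply: quasi_ge0_near; near=> t.
  have -> : m t - (xa t + th * (m t - xa t)) = (1 - th) * (m t - xa t) by ring.
  exact: mulr_ge0.
Unshelve. all: by end_near. Qed.

(* Monotonicity of the integral: if g <= f on [a,b] then
   \int_a^b g <= \int_a^b f, where \int_a^b h = I_h(b) for the
   (unique) primitive I_h of h on J with I_h(a) = 0. *)
Theorem theorem29 (R : realType) (J : set (FR R)) (f g : FR R -> FR R)
    (a b : FR R) :
  ninf_interval J -> fsmooth J f -> fsmooth J g ->
  J a -> J b -> flt a b ->
  (forall x, fle a x -> fle x b -> fle (g x) (f x)) ->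
  forall If Ig : FR R -> FR R,
    is_integral_fun J f a If -> is_integral_fun J g a Ig ->
    fle (Ig b) (If b).
Proof.
move=> HJ _ _ Ja Jb [ab _] gf If Ig [sIf [If0 dIf]] [sIg [Ig0 dIg]].
have [xa aa] := rep_ex a; have [xb bb] := rep_ex b.
have mono X x := @monotone_local R J f g If Ig a b X x HJ gf sIf sIg dIf dIg.
pose Q r := forall Y y u v, fle a Y -> fle Y b -> rep Y y -> y 0 <= r ->
  rep (If Y) u -> rep (Ig Y) v -> quasi_ge0 (fun t => u t - v t).
pose S := [set r : R | xa 0 <= r <= xb 0 /\ Q r].
have ab0 : xa 0 <= xb 0 := fle_std aa bb ab.
have Sa : S (xa 0).
  split; first by rewrite lexx.
  move=> Y y u v aY Yb Yy ya IfY IgY.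
  have [d d0
    /(_ a Y xa y _ _ _ _ Ja _ (fle_refl a) aY Yb aa Yy _ _ If0 IfY Ig0 IgY) H] := mono a xa Ja aa.
  have {H}: quasi_ge0 (fun t => u t - v t - (0 - 0)).
    apply: H; first exact: (ninf_interval_convex HJ Ja Jb).
      by rewrite subrr normr0 ltW.
    have ya' := fle_std aa Yy aY.
    by rewrite (_ : y 0 = xa 0) ?subrr ?normr0 ?ltW//; apply/eqP; rewrite eq_le ya.
  by apply: quasi_ge0_ext => t; rewrite !subr0.
have Sub : ubound S (xb 0) by move=> r [/andP[]].
have Ssup : has_sup S by split; [exists (xa 0)|exists (xb 0)].
pose s := sup S.
have as_ : xa 0 <= s by apply: ub_le_sup Sa; case: Ssup.
have sb : s <= xb 0 by apply: ge_sup => //; case: Ssup.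
have [X0 [x0 [Xx0 x00 aX0 X0b]]] := @fle_intermediate R a b xa xb s ab aa bb (ltac:(by rewrite as_)).
have JX0 := ninf_interval_convex HJ Ja Jb aX0 X0b.
have [d d0 Hd] := mono X0 x0 JX0 Xx0; rewrite x00 in Hd.
have [e [/andP[ae eb] Qe] se] := sup_adherent d0 Ssup.
have es : e <= s.
  by apply: ub_le_sup; [case: Ssup|split=> //; rewrite ae].
pose r1 := Num.min (s + d) (xb 0).
have Q1 : Q r1.
  move=> Y y u v aY Yb Yy yr IfY IgY.
  have [ye|ye] := leP (y 0) e; first exact: (Qe Y y).
  have [X [x [Xx xe aX Xb]]] := @fle_intermediate R a b xa xb e ab aa bb ltac:(by rewrite ae).
  have XY : fle X Y by apply: (std_fle Xx Yy); rewrite xe.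
  have JX := ninf_interval_convex HJ Ja Jb aX Xb.
  have JY := ninf_interval_convex HJ Ja Jb aY Yb.
  have [u' IfX] := rep_ex (If X); have [v' IgX] := rep_ex (Ig X).
  have H1 : quasi_ge0 (fun t => u' t - v' t) by apply: (Qe X x) => //; rewrite xe.
  have ys : y 0 <= s + d by move: yr; rewrite le_min => /andP[].
  have se' : s - d < e := se.
  have H2 := Hd X Y x y u' u v' v JX JY aX XY Yb Xx Yy _ _ IfX IfY IgX IgY.
  have {}H2 : quasi_ge0 (fun t => u t - v t - (u' t - v' t)).
    by apply: H2; rewrite ?xe ler_norml; lra.
  by apply: quasi_ge0_ext (quasi_ge0D H1 H2) => t; rewrite subrKC.
have S1 : S r1.
  split=> //; rewrite ge_min lexx orbT andbT le_min ab0 andbT.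
  by rewrite (le_trans as_)// lerDl ltW.
have r1s : r1 <= s by apply: ub_le_sup S1; case: Ssup.
have Er1 : r1 = xb 0.
  by move: r1s; rewrite /r1; case: (leP (s + d) (xb 0)) => //; lra.
have [u Iu] := rep_ex (If b); have [v Iv] := rep_ex (Ig b).
apply/(fleP Iv Iu); apply: (Q1 b xb) => //; first exact: fle_refl.
by rewrite Er1.
Qed.
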